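(* Let $f,g\in\mathcal{A}_c(\mathbb{T})$. Then: (a) $\widehat{f+g}(n)=\hat f(n)+\hat g(n)$ for all $n\in\mathbb{Z}$; (b) if $\alpha\in\mathbb{C}$ then $\widehat{(\alpha f)}(n)=\alpha\hat f(n)$ for all $n\in\mathbb{Z}$; (c) $\overline{\hat f(n)}=\hat f(-n)$ for all $n\in\mathbb{Z}$; (d) if $s\in\mathbb{R}$ then $\widehat{\tau_s f}(n)=\hat f(n)e^{-ins}$ for all $n\in\mathbb{Z}$; (e) $|\hat f(n)|\le |F(\pi)|+|n|\int_{-\pi}^{\pi}|F|$ for all $n\in\mathbb{Z}$, where $F(x)=\int_{-\pi}^x f$; (f) for $n\neq 0$, $|\hat f(n)|\le 4\sqrt2\,|n|\,\|f\|_{\mathbb{T}}$; (g) $\hat f(n)=o(n)$ as $|n|\to\infty$, and this estimate is sharp: for every $\psi:\mathbb{N}\to(0,\infty)$ with $\psi(n)=o(n)$ as $n\to\infty$ there is $f\in\mathcal{A}_c(\mathbb{T})$ such that it is not the case that $\hat f(n)=o(\psi(|n|))$ as $|n|\to\infty$; (h) for $n\neq0$, $|\hat f(n)|\le 2\sqrt2\,|n|\,\|f-\tau_{\pi/n}f\|_{\mathbb{T}}$; (i) if $F\in C^0(\mathbb{T})$ then $\widehat{F'}(n)=in\hat F(n)$ for all $n\in\mathbb{Z}$, where $F'$ is the distributional derivative; (j) if $F\in C^{k-1}(\mathbb{T})$ for some $k\in\mathbb{N}$ then for $n\ne0$ and each $0\le\ell\le k$, $\hat F(n)=(in)^{-\ell}\widehat{F^{(\ell)}}(n)$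 and $$|\hat F(n)|\le 4\sqrt2\min_{0\le\ell\le k}\frac{\|F^{(\ell)}\|_{\mathbb{T}}}{|n|^{\ell-1}};$$ moreover $\hat F(n)=o(n^{1-k})$ as $|n|\to\infty$. (Here $F^{(\ell)}$ is the distributional derivative of order $\ell$.)
   Context: ''Periodic'' means $2\pi$-periodic, and $\mathbb{T}$ is modelled by $[-\pi,\pi)$. $C^k(\mathbb{T})$ is the space of $2\pi$-periodic $k$-times continuously differentiable real functions on $\mathbb{R}$. Functions and distributions are real-valued unless complex scalars appear; for complex-valued objects the real and imaginary parts are treated separately. $\mathcal{B}_c(\mathbb{T})$ is the set of continuous $F:\mathbb{R}\to\mathbb{R}$ with $F(-\pi)=0$ and $F(y+2n\pi)=F(y)+nF(\pi)$ for all $y\in[-\pi,\pi)$, $n\in\mathbb{Z}$. $\mathcal{A}_c(\mathbb{T})$ is the set of Schwartz distributions $f$ on $\mathbb{R}$ such that $f=F'$ (distributional derivative) for some $F\in\mathcal{B}_c(\mathbb{T})$; this $F$ is unique and is called the primitive of $f$. The continuous primitive integral is $\int_a^b f=F(b)-F(a)$. Periodic locally Lebesgue integrable functions are identified with elements of $\mathcal{A}_c(\mathbb{T})$; distributional derivatives of functions in $C^0(\mathbb{T})$ belong to $\mathcal{A}_c(\mathbb{T})$. The Alexiewicz norm is $\|f\|_{\mathbb{T}}=\sup_{|I|\le2\pi}\left|\int_I f\right|$, supremum over intervals $I\subset\mathbb{R}$ of length at most $2\pi$. For $f\in\mathcal{A}_c(\mathbb{T})$ with primitive $F$ and $g$ periodic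 of bounded variation, $\int_{-\pi}^{\pi}fg=F(\pi)g(\pi)-\int_{-\pi}^{\pi}F\,dg$ (Riemann--Stieltjes). The Fourier coefficients are $\hat f(n)=\int_{-\pi}^{\pi}f(t)e^{-int}\,dt$, equivalently $\hat f(n)=(-1)^nF(\pi)+in\int_{-\pi}^{\pi}F(t)e^{-int}\,dt$, $n\in\mathbb{Z}$. Translation: $\langle\tau_sf,\phi\rangle=\langle f,\tau_{-s}\phi\rangle$ for test functions $\phi$, where $\tau_s\phi(y)=\phi(y-s)$. *)

(* Defs.v *)
From Stdlib Require Import Reals ZArith ClassicalEpsilon.
From Coquelicot Require Import Coquelicot.
Open Scope R_scope.

Definition vanishes_outside (M : R) (phi : R -> R) : Prop :=
  forall x, M < Rabs x -> phi x = 0.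

Definition test_function (phi : R -> R) : Prop :=
  (forall (j : nat) (x : R), ex_derive_n phi j x) /\
  exists M : R, vanishes_outside M phi.

(* Convergence to 0 in D(R): supports in a common compact set, and uniform
   convergence of the derivatives of each order. *)
Definition test_cvg0 (phi : nat -> R -> R) : Prop :=
  (exists M : R, forall m, vanishes_outside M (phi m)) /\
  forall (j : nat) (eps : posreal),
    eventually (fun m => forall x, Rabs (Derive_n (phi m) j x) < eps).

(* Only the values of a functional on test functions are meaningful; equality of
   distributions is [dist_eq]. *)
Definition functional : Type := (R -> R) -> R.
Definition Cfunctional : Type := (R -> R) -> C.

Definition is_distribution (T : functional) : Prop :=
  (forall (phi psi : R -> R) (a b : R),
     test_function phi -> test_function psi ->
     T (fun x => a * phi x + b * psi x) = a * T phi + b * T psi) /\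
  (forall phi : nat -> R -> R,
     (forall m, test_function (phi m)) -> test_cvg0 phi ->
     is_lim_seq (fun m => T (phi m)) 0).

Definition dist_eq (S T : functional) : Prop :=
  forall phi, test_function phi -> S phi = T phi.

Definition dist_plus (S T : functional) : functional := fun phi => S phi + T phi.
Definition dist_minus (S T : functional) : functional := fun phi => S phi - T phi.
Definition dist_Cscal (alpha : C) (T : functional) : Cfunctional :=
  fun phi => Cmult alpha (RtoC (T phi)).

Definition dist_deriv (T : functional) : functional := fun phi => - T (Derive phi).
Definition dist_deriv_n (T : functional) (l : nat) : functional :=
  Nat.iter l dist_deriv T.

Definition translate (s : R) (phi : R -> R) : R -> R := fun y => phi (y - s).
Definition dist_translate (s : R) (T : functional) : functional :=
  fun phi => T (translate (- s) phi).

(* The distribution identified with a function; it is only used for continuous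
   functions, so that the Riemann integral suffices. *)
Definition dist_of_fun (F : R -> R) : functional :=
  fun phi => RInt_gen (fun x => F x * phi x)
               (Rbar_locally m_infty) (Rbar_locally p_infty).

Definition CkT (k : nat) (F : R -> R) : Prop :=
  (forall x, F (x + 2 * PI) = F x) /\
  (forall (j : nat) (x : R), (j <= k)%nat ->
     ex_derive_n F j x /\ continuous (Derive_n F j) x).

Definition Bc (F : R -> R) : Prop :=
  (forall x, continuous F x) /\
  F (- PI) = 0 /\
  (forall (y : R) (n : Z), - PI <= y < PI ->
     F (y + 2 * IZR n * PI) = F y + IZR n * F PI).

Definition is_primitive (f : functional) (F : R -> R) : Prop :=
  Bc F /\ dist_eq f (dist_deriv (dist_of_fun F)).

Definition Ac (f : functional) : Prop :=
  is_distribution f /\ exists F, is_primitive f F.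

(* For [Ac f] the primitive exists and is unique. *)
Definition primitive (f : functional) : R -> R :=
  epsilon (inhabits (fun _ => 0)) (is_primitive f).

Definition cp_int (f : functional) (a b : R) : R := primitive f b - primitive f a.

(* The intervals with endpoints a <= b have the same integral whether or not they
   contain their endpoints. The supremum is finite for [Ac f]. *)
Definition alexiewicz_norm (f : functional) : R :=
  real (Lub_Rbar (fun r => exists a b : R,
    a <= b /\ b - a <= 2 * PI /\ r = Rabs (cp_int f a b))).

(* Riemann-Stieltjes sums and integral of F with respect to dg, along the filter of
   tagged subdivisions used for [is_RInt]; for a <= b. *)
Definition RS_sum (F g : R -> R) (ptd : SF_seq (T := R)) : R :=
  seq.foldr Rplus 0
    (seq.pairmap (fun x y : R * R => F (snd y) * (g (fst y) - g (fst x)))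
       (SF_h ptd, 0) (SF_t ptd)).

Definition is_RSInt (F g : R -> R) (a b l : R) : Prop :=
  filterlim (RS_sum F g) (Riemann_fine a b) (locally l).

Definition RSInt (F g : R -> R) (a b : R) : R := iota (is_RSInt F g a b).

(* The integral of f g over [-pi, pi], for g periodic of bounded variation. *)
Definition cp_int_mult (f : functional) (g : R -> R) : R :=
  primitive f PI * g PI - RSInt (primitive f) g (- PI) PI.

Definition cp_int_Cmult (f : functional) (g : R -> C) : C :=
  (cp_int_mult f (fun t => Re (g t)), cp_int_mult f (fun t => Im (g t))).

Definition expi (x : R) : C := (cos x, sin x).

Definition fourier (f : functional) (n : Z) : C :=
  cp_int_Cmult f (fun t => expi (- (IZR n * t))).

Definition Cfourier (h : Cfunctional) (n : Z) : C :=
  Cplus (fourier (fun phi => Re (h phi)) n)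
        (Cmult Ci (fourier (fun phi => Im (h phi)) n)).

Definition Z_infty (P : Z -> Prop) : Prop :=
  exists N : Z, forall n : Z, (N <= Z.abs n)%Z -> P n.

(* a(n) = o(b(n)): in [is_domin] the dominating function comes first. *)
Definition little_o_Z (a : Z -> C) (b : Z -> R) : Prop :=
  is_domin Z_infty b (fun n => Cmod (a n)).

Fixpoint min_upto (u : nat -> R) (k : nat) : R :=
  match k with
  | O => u O
  | S k' => Rmin (min_upto u k') (u (S k'))
  end.

(* Main.v *)
Require Import Defs.
From Stdlib Require Import Reals ZArith Lra Lia.
From Stdlib Require Import FunctionalExtensionality PropExtensionality ClassicalEpsilon.
From Coquelicot Require Import Coquelicot.
Open Scope R_scope.

(** Everything is read off the primitive.  If [f] has primitive [F], write
    [coef F n th = F(pi) cos(n pi + th) + n * int_{-pi}^{pi} F(t) sin(n t + th) dt],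
    the integral of [f] against the wave [cos(n t + th)].  The real and imaginary
    parts of the Fourier coefficient are the values at the phases [0] and [pi/2]
    ([fourier_coef]), and a general phase is the real part of the coefficient rotated by a
    unit complex number ([coef_rotate]); so the modulus of the coefficient is [coef F n phi]
    for a suitable [phi] ([Cmod_fourier_coef]), and real estimates of [coef] lose nothing.

    Two facts make this reading legitimate.  The primitive is unique
    ([is_primitive_unique]): a continuous function with zero distributional derivative is
    constant, because the difference of two bumps of equal mass, concentrated near [a] and
    near [b], is the derivative of a test function.  And a Riemann-Stieltjes integral with
    respect to a C^1 integrator [g] is the Riemann integral with density [g'] ([RSInt_C1]).

    Linearity, conjugation and translation are then properties of [coef].  Translation uses
    that, [F] growing by [F(pi)] per period, the pairing can be computed over any period
    [[a, a + 2 pi]] ([coef_base_point]).  The same freedom gives the norm estimate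
    ([coef_le_norm]): choose [a] at a zero of [cos(n t + th)], so that the boundary term
    vanishes, and replace [F] by [F - F(a)], which is bounded by the Alexiewicz norm on
    the period; what remains is the integral of [|sin(n t + th)|], which is at most
    [sqrt 2 * pi <= 4 sqrt 2] by the inequality of the means.  Translation by [pi/n]
    multiplies the [n]-th coefficient by [-1], so this estimate, applied to
    [f - tau_{pi/n} f], yields the half-period estimate ([fourier_le_half_period]), and with
    the uniform continuity of [F] the bound [o(n)] ([fourier_little_o]).

    For sharpness ([little_o_sharp]), choose frequencies [n_k > k] with
    [psi(n_k) <= 2^(-k) n_k] and take the derivative of the continuous function
    [sum_k 2^(-k) sin(n_k t)]; its coefficient at [n_k] is at least [pi psi(n_k)].

    If [F] is continuous and periodic, an integration by parts shows that the [n]-th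
    coefficient of [F'] is [i n] times that of [F] ([fourier_dist_deriv]).  The statements on
    higher derivatives follow by induction on the order, since the distributional and the
    classical derivatives of a C^1 function agree ([dist_deriv_C1]). *)

(** * Smooth functions and bumps *)

(** The outermost recursion is on [Derive f], unlike in [ex_derive_n]; this turns
    closure under sums and products into plain inductions. *)
Fixpoint times_diff (n : nat) (f : R -> R) : Prop :=
  match n with
  | O => True
  | S n' => (forall x, ex_derive f x) /\ times_diff n' (Derive f)
  end.

Definition smooth (f : R -> R) : Prop := forall n, times_diff n f.

Lemma Derive_n_S_inner (f : R -> R) (n : nat) :
  Derive_n f (S n) = Derive_n (Derive f) n.
Proof.
  apply functional_extensionality; intro x.
  rewrite <- Nat.add_1_r; symmetry; apply (Derive_n_comp f n 1 x).
Qed.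

Lemma smooth_iff_ex_derive_n (f : R -> R) :
  smooth f <-> forall (j : nat) (x : R), ex_derive_n f j x.
Proof.
  split.
  - intros Hf j. generalize (Hf j). clear Hf. revert f.
    induction j as [|j IH]; intros f Hf x; [exact I|].
    destruct Hf as [H1 H2]. destruct j as [|j]; [exact (H1 x)|].
    change (ex_derive (Derive_n f (S j)) x). rewrite Derive_n_S_inner.
    exact (IH _ H2 x).
  - intros Hf n. revert f Hf. induction n as [|n IH]; intros f Hf; [exact I|].
    split; [exact (Hf 1%nat)|]. apply IH. intros [|j] x; [exact I|].
    simpl. rewrite <- Derive_n_S_inner. exact (Hf (S (S j)) x).
Qed.

Lemma times_diff_weaken (n : nat) (f : R -> R) : times_diff (S n) f -> times_diff n f.
Proof.
  revert f; induction n as [|n IH]; intros f [H1 H2]; [exact I|].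
  split; [exact H1|]. apply IH; exact H2.
Qed.

Lemma times_diff_plus (n : nat) (f g : R -> R) :
  times_diff n f -> times_diff n g -> times_diff n (fun x => f x + g x).
Proof.
  revert f g; induction n as [|n IH]; intros f g; [easy|].
  intros [f1 f2] [g1 g2]. split.
  - intro x. apply (ex_derive_plus f g); auto.
  - replace (Derive _) with (fun x => Derive f x + Derive g x); [now apply IH|].
    apply functional_extensionality; intro x. now rewrite Derive_plus.
Qed.

Lemma times_diff_mult (n : nat) (f g : R -> R) :
  times_diff n f -> times_diff n g -> times_diff n (fun x => f x * g x).
Proof.
  revert f g; induction n as [|n IH]; intros f g; [easy|].
  intros Hf Hg. pose proof (times_diff_weaken _ _ Hf). pose proof (times_diff_weaken _ _ Hg).
  destruct Hf as [f1 f2], Hg as [g1 g2]. split.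
  - intro x. apply (ex_derive_mult f g); auto.
  - replace (Derive _) with (fun x => Derive f x * g x + f x * Derive g x).
    + apply times_diff_plus; now apply IH.
    + apply functional_extensionality; intro x. now rewrite Derive_mult.
Qed.

Lemma times_diff_const (n : nat) (c : R) : times_diff n (fun _ => c).
Proof.
  revert c; induction n as [|n IH]; intro c; [exact I|]. split.
  - intro x. apply ex_derive_const.
  - replace (Derive _) with (fun _ : R => 0); [apply IH|].
    apply functional_extensionality; intro x. now rewrite Derive_const.
Qed.

Lemma times_diff_affine (n : nat) (f : R -> R) (u v : R) :
  times_diff n f -> times_diff n (fun x => f (u * x + v)).
Proof.
  revert f; induction n as [|n IH]; intros f; [easy|]. intros [f1 f2].
  assert (D : forall x, is_derive (fun x => f (u * x + v)) x (u * Derive f (u * x + v))).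
  { intro x. auto_derive; [auto|]. change (Derive (fun x => f x)) with (Derive f). ring. }
  split.
  - intro x. eexists; apply D.
  - replace (Derive _) with (fun x => u * Derive f (u * x + v)).
    + apply (times_diff_mult n (fun _ => u)); [apply times_diff_const | now apply IH].
    + apply functional_extensionality; intro x. symmetry; now apply is_derive_unique.
Qed.

(** The functions [exp(-1/x) / x^k], extended by 0 to the left of the origin, are closed
    under differentiation up to linear combinations ([is_derive_flat]), so that all of them
    are shown to be smooth by a single induction. *)
Definition flat (k : nat) (x : R) : R :=
  if Rle_dec x 0 then 0 else exp (- / x) / x ^ k.

Lemma flat_pos (k : nat) (x : R) : 0 < x -> 0 < flat k x.
Proof.
  intro H. unfold flat. destruct (Rle_dec x 0); [lra|].
  apply Rdiv_lt_0_compat; [apply exp_pos | now apply pow_lt].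
Qed.

Lemma flat_nonpos (k : nat) (x : R) : x <= 0 -> flat k x = 0.
Proof. intro H. unfold flat. now destruct (Rle_dec x 0). Qed.

Lemma pow_le_exp (m : nat) (y : R) : 0 <= y -> y ^ m <= INR (fact m) * exp y.
Proof.
  intro Hy.
  assert (T : forall k, 0 <= y ^ k / INR (fact k)).
  { intro k. apply Rmult_le_pos; [now apply pow_le|].
    apply Rlt_le, Rinv_0_lt_compat, INR_fact_lt_0. }
  assert (H : y ^ m / INR (fact m) <= exp y).
  { apply Rle_trans with (2 := exp_ge_taylor y m Hy).
    destruct m as [|m]; [apply Rle_refl|]. rewrite tech5.
    generalize (cond_pos_sum _ m T). lra. }
  apply Rmult_le_compat_l with (r := INR (fact m)) in H; [|apply pos_INR].
  replace (INR (fact m) * _) with (y ^ m) in H; [exact H|].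
  field. apply INR_fact_neq_0.
Qed.

(** A quadratic bound at the origin gives differentiability there, with derivative 0.
    It holds because [exp] dominates every power at infinity. *)
Lemma flat_le_sqr (k : nat) : exists C, 0 < C /\ forall x, Rabs (flat k x) <= C * x ^ 2.
Proof.
  set (C := INR (fact (k + 2))). assert (HC : 0 < C) by apply INR_fact_lt_0.
  exists C; split; [exact HC|]. intro x.
  destruct (Rle_dec x 0) as [Hx|Hx].
  - rewrite flat_nonpos, Rabs_R0 by exact Hx.
    apply Rmult_le_pos; [lra | apply pow2_ge_0].
  - assert (Hx' : 0 < x) by lra. clear Hx.
    rewrite Rabs_pos_eq by (apply Rlt_le, flat_pos, Hx').
    unfold flat. destruct (Rle_dec x 0); [lra|].
    assert (P : 0 < / x) by now apply Rinv_0_lt_compat.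
    pose proof (pow_le_exp (k + 2) (/ x) (Rlt_le _ _ P)) as H. fold C in H.
    rewrite exp_Ropp.
    assert (0 < exp (/ x)) by apply exp_pos.
    assert (0 < x ^ k) by now apply pow_lt.
    apply Rmult_le_reg_r with (exp (/ x) * x ^ k); [now apply Rmult_lt_0_compat|].
    replace (/ exp (/ x) / x ^ k * (exp (/ x) * x ^ k)) with 1 by (field; lra).
    apply Rle_trans with (C * exp (/ x) * x ^ (k + 2)).
    + replace 1 with ((/ x) ^ (k + 2) * x ^ (k + 2)).
      * apply Rmult_le_compat_r; [apply pow_le; lra | exact H].
      * rewrite <- Rpow_mult_distr, Rinv_l by lra. apply pow1.
    + rewrite pow_add. apply Req_le. ring.
Qed.

Lemma is_derive_flat (k : nat) (x : R) :
  is_derive (flat k) x (flat (k + 2) x + (- INR k) * flat (k + 1) x).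
Proof.
  destruct (Rtotal_order x 0) as [Hx | [Hx | Hx]].
  - rewrite !flat_nonpos by lra. replace (0 + - INR k * 0) with 0 by ring.
    apply is_derive_ext_loc with (fun _ => 0).
    + apply (locally_interval _ x m_infty 0); simpl; auto. intros y _ Hy.
      symmetry. apply flat_nonpos. lra.
    + apply @is_derive_const.
  - subst x. rewrite !flat_nonpos by lra. replace (0 + - INR k * 0) with 0 by ring.
    destruct (flat_le_sqr k) as [C [HC H]].
    apply is_derive_Reals. intros eps Heps.
    assert (Hd : 0 < eps / C) by now apply Rdiv_lt_0_compat.
    exists (mkposreal _ Hd). intros h Hh0 Hh. simpl in Hh.
    rewrite Rplus_0_l, (flat_nonpos k 0), !Rminus_0_r by lra.
    unfold Rdiv. rewrite Rabs_mult, Rabs_inv.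
    assert (P : 0 < Rabs h) by now apply Rabs_pos_lt.
    apply Rmult_lt_reg_r with (Rabs h); [exact P|].
    rewrite Rmult_assoc, Rinv_l, Rmult_1_r by lra.
    apply Rle_lt_trans with (1 := H h). rewrite <- pow2_abs.
    replace (C * Rabs h ^ 2) with ((C * Rabs h) * Rabs h) by ring.
    apply Rmult_lt_compat_r; [exact P|].
    apply (Rmult_lt_compat_l C) in Hh; [|exact HC].
    replace (C * (eps / C)) with eps in Hh by (field; lra). exact Hh.
  - apply is_derive_ext_loc with (fun x => exp (- / x) / x ^ k).
    + apply (locally_interval _ x 0 p_infty); simpl; auto. intros y Hy _.
      unfold flat. destruct (Rle_dec y 0); [lra | reflexivity].
    + assert (x ^ k <> 0) by (apply pow_nonzero; lra).
      unfold flat. destruct (Rle_dec x 0); [lra|].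
      auto_derive; [repeat split; lra|].
      rewrite !pow_add. destruct k as [|k]; simpl; [field; lra|].
      assert (x ^ k <> 0) by (apply pow_nonzero; lra).
      destruct k; simpl; [field; lra|]. simpl in *. field. repeat split; try lra.
      apply pow_nonzero; lra.
Qed.

Lemma smooth_flat (k : nat) : smooth (flat k).
Proof.
  intro n. revert k. induction n as [|n IH]; intro k; [exact I|]. split.
  - intro x. eexists. apply is_derive_flat.
  - replace (Derive (flat k)) with (fun x => flat (k + 2) x + (- INR k) * flat (k + 1) x).
    + apply (times_diff_plus n (flat (k + 2)) (fun x => - INR k * flat (k + 1) x)); [apply IH|].
      apply (times_diff_mult n (fun _ => - INR k)); [apply times_diff_const | apply IH].
    + apply functional_extensionality; intro x. symmetry.
      apply is_derive_unique, is_derive_flat.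
Qed.

(** A smooth function supported in [[c - eps, c + eps]]. *)
Definition bump (c eps x : R) : R := flat 0 (x + (eps - c)) * flat 0 (- x + (c + eps)).

Lemma smooth_bump (c eps : R) : smooth (bump c eps).
Proof.
  intro n. unfold bump.
  apply (times_diff_mult n (fun x => flat 0 (x + (eps - c)))).
  - replace (fun x => flat 0 (x + (eps - c))) with (fun x => flat 0 (1 * x + (eps - c))).
    + apply times_diff_affine, smooth_flat.
    + apply functional_extensionality; intro x. now rewrite Rmult_1_l.
  - replace (fun x => flat 0 (- x + (c + eps))) with (fun x => flat 0 ((-1) * x + (c + eps))).
    + apply times_diff_affine, smooth_flat.
    + apply functional_extensionality; intro x. f_equal. ring.
Qed.

Lemma bump_ge_0 (c eps x : R) : 0 <= bump c eps x.
Proof.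
  assert (H : forall y, 0 <= flat 0 y).
  { intro y. destruct (Rle_lt_dec y 0); [rewrite flat_nonpos by easy; lra|].
    now apply Rlt_le, flat_pos. }
  apply Rmult_le_pos; apply H.
Qed.

Lemma bump_pos (c eps x : R) : Rabs (x - c) < eps -> 0 < bump c eps x.
Proof.
  intro H. apply Rabs_def2 in H. apply Rmult_lt_0_compat; apply flat_pos; lra.
Qed.

Lemma bump_outside (c eps x : R) : eps <= Rabs (x - c) -> bump c eps x = 0.
Proof.
  intro H. unfold bump. destruct (Rle_lt_dec 0 (x - c)).
  - rewrite Rabs_pos_eq in H by easy. rewrite (flat_nonpos 0 (- x + _)) by lra. ring.
  - rewrite Rabs_left in H by easy. rewrite flat_nonpos by lra. ring.
Qed.

Lemma bump_shift (c eps x : R) : bump c eps x = bump 0 eps (x - c).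
Proof. unfold bump. f_equal; f_equal; ring. Qed.

(** * Integrals of continuous functions *)

(** [RInt] is typed in the carrier of a normed module, where [ring] finds no ring;
    subtracting the two sides brings the equation back to [R]. *)
Ltac Rring := apply Rminus_diag_uniq; ring.

Definition cont (f : R -> R) : Prop := forall x, continuous f x.

Lemma cont_const (c : R) : cont (fun _ => c).
Proof. intro x. apply continuous_const. Qed.

Lemma cont_plus (f g : R -> R) : cont f -> cont g -> cont (fun x => f x + g x).
Proof. intros Hf Hg x. apply (continuous_plus f g); auto. Qed.

Lemma cont_minus (f g : R -> R) : cont f -> cont g -> cont (fun x => f x - g x).
Proof. intros Hf Hg x. apply (continuous_minus f g); auto. Qed.

Lemma cont_mult (f g : R -> R) : cont f -> cont g -> cont (fun x => f x * g x).
Proof. intros Hf Hg x. apply (continuous_mult f g); auto. Qed.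

Lemma cont_comp (f g : R -> R) : cont f -> cont g -> cont (fun x => f (g x)).
Proof. intros Hf Hg x. apply (continuous_comp g f); auto. Qed.

Lemma cont_Rabs (f : R -> R) : cont f -> cont (fun x => Rabs (f x)).
Proof. intros Hf x. apply (continuous_comp f Rabs); [auto | apply continuous_Rabs]. Qed.

Lemma cont_id : cont (fun x => x).
Proof. intro x. apply continuous_id. Qed.

Lemma cont_derivable (f df : R -> R) : (forall x, is_derive f x (df x)) -> cont f.
Proof. intros H x. apply (ex_derive_continuous f). eexists; apply H. Qed.

#[local] Hint Resolve cont_const cont_plus cont_minus cont_mult cont_Rabs cont_id : cont.

Lemma ex_RInt_cont (f : R -> R) (a b : R) : cont f -> ex_RInt f a b.
Proof. intro H. apply (ex_RInt_continuous f). intros; apply H. Qed.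

#[local] Hint Resolve ex_RInt_cont : cont.

Lemma RInt_plus_cont (f g : R -> R) (a b : R) : cont f -> cont g ->
  RInt (fun x => f x + g x) a b = RInt f a b + RInt g a b.
Proof. intros Hf Hg. apply (RInt_plus f g); auto with cont. Qed.

Lemma RInt_minus_cont (f g : R -> R) (a b : R) : cont f -> cont g ->
  RInt (fun x => f x - g x) a b = RInt f a b - RInt g a b.
Proof. intros Hf Hg. apply (RInt_minus f g); auto with cont. Qed.

Lemma RInt_scal_cont (c : R) (f : R -> R) (a b : R) : cont f ->
  RInt (fun x => c * f x) a b = c * RInt f a b.
Proof. intros Hf. apply (RInt_scal f); auto with cont. Qed.

Lemma RInt_const_R (c a b : R) : RInt (fun _ => c) a b = (b - a) * c.
Proof. apply (RInt_const (V := R_CompleteNormedModule)). Qed.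

Lemma RInt_Chasles_cont (f : R -> R) (a b c : R) : cont f ->
  RInt f a b + RInt f b c = RInt f a c.
Proof. intro H. apply (RInt_Chasles f); auto with cont. Qed.

Lemma RInt_shift (f : R -> R) (c a b : R) : cont f ->
  RInt (fun x => f (x + c)) a b = RInt f (a + c) (b + c).
Proof.
  intro H. generalize (RInt_comp_lin f 1 c a b). rewrite !Rmult_1_l.
  intro E. rewrite <- E by auto with cont. apply RInt_ext. intros x _.
  change (f (x + c) = 1 * f (1 * x + c)). now rewrite !Rmult_1_l.
Qed.

Lemma RInt_of_derivative (f df : R -> R) (a b : R) :
  (forall x, is_derive f x (df x)) -> cont df -> RInt df a b = f b - f a.
Proof.
  intros D C. apply is_RInt_unique. apply (is_RInt_derive f df); intros; auto.
Qed.

Lemma is_derive_RInt_cont (f : R -> R) (a x : R) : cont f ->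
  is_derive (fun y => RInt f a y) x (f x).
Proof.
  intro H. apply is_derive_RInt with a; [|apply H].
  apply filter_forall. intro y. apply (RInt_correct f). auto with cont.
Qed.

Lemma RInt_support (f : R -> R) (A p q B : R) : cont f -> A <= p -> p <= q -> q <= B ->
  (forall x, x < p \/ q < x -> f x = 0) -> RInt f A B = RInt f p q.
Proof.
  intros Hf H1 H2 H3 Z.
  rewrite <- (RInt_Chasles_cont f A p B), <- (RInt_Chasles_cont f p q B) by exact Hf.
  assert (E : forall u v, (forall x, Rmin u v < x < Rmax u v -> f x = 0) -> RInt f u v = 0).
  { intros u v Huv. rewrite (RInt_ext f (fun _ => 0)) by exact Huv.
    rewrite RInt_const_R. Rring. }
  rewrite (E A p) by (intros x; rewrite Rmax_right by exact H1; intros; apply Z; lra).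
  rewrite (E q B) by (intros x; rewrite Rmin_left by exact H3; intros; apply Z; lra).
  Rring.
Qed.

Lemma RInt_parts (f df g dg : R -> R) (a b : R) :
  (forall x, is_derive f x (df x)) -> (forall x, is_derive g x (dg x)) -> cont df -> cont dg ->
  RInt (fun x => df x * g x) a b = f b * g b - f a * g a - RInt (fun x => f x * dg x) a b.
Proof.
  intros Df Dg Cdf Cdg.
  pose proof (cont_derivable _ _ Df). pose proof (cont_derivable _ _ Dg).
  rewrite <- (RInt_of_derivative (fun x => f x * g x) (fun x => df x * g x + f x * dg x)).
  - rewrite RInt_plus_cont by auto with cont. Rring.
  - intro x. apply (is_derive_mult f g x (df x) (dg x)); auto. intros; apply Rmult_comm.
  - auto with cont.
Qed.

(** * Test functions and distributions given by continuous functions *)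

Lemma vanishes_outside_weaken (M M' : R) (phi : R -> R) :
  M <= M' -> vanishes_outside M phi -> vanishes_outside M' phi.
Proof. intros H V x Hx. apply V. lra. Qed.

Lemma test_function_support (phi : R -> R) :
  test_function phi -> exists M, 0 <= M /\ vanishes_outside M phi.
Proof.
  intros [_ [M H]]. exists (Rmax 0 M). split; [apply Rmax_l|].
  apply vanishes_outside_weaken with (2 := H). apply Rmax_r.
Qed.

Lemma test_function_is_derive (phi : R -> R) (x : R) :
  test_function phi -> is_derive phi x (Derive phi x).
Proof. intros [H _]. apply Derive_correct. exact (H 1%nat x). Qed.

Lemma test_function_cont (phi : R -> R) : test_function phi -> cont phi.
Proof.
  intro H. apply cont_derivable with (Derive phi). intro; now apply test_function_is_derive.
Qed.

Lemma vanishes_outside_Derive (M : R) (phi : R -> R) :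
  vanishes_outside M phi -> vanishes_outside M (Derive phi).
Proof.
  intros V x Hx. rewrite <- (Derive_const 0 x). apply Derive_ext_loc.
  assert (P : 0 < Rabs x - M) by lra. exists (mkposreal _ P). intros y Hy. apply V.
  change (Rabs (y - x) < Rabs x - M) in Hy. generalize (Rabs_triang_inv x y).
  rewrite Rabs_minus_sym. lra.
Qed.

Lemma test_function_Derive (phi : R -> R) : test_function phi -> test_function (Derive phi).
Proof.
  intros [S [M V]]. split.
  - apply smooth_iff_ex_derive_n. intro n. apply smooth_iff_ex_derive_n in S.
    exact (proj2 (S (Datatypes.S n))).
  - exists M. now apply vanishes_outside_Derive.
Qed.

Lemma test_function_lin (phi psi : R -> R) (a b : R) : test_function phi ->
  test_function psi -> test_function (fun x => a * phi x + b * psi x).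
Proof.
  intros Hp Hq.
  destruct (test_function_support _ Hp) as [M [M0 VM]].
  destruct (test_function_support _ Hq) as [N [N0 VN]].
  destruct Hp as [Sp _], Hq as [Sq _]. split.
  - apply smooth_iff_ex_derive_n. apply smooth_iff_ex_derive_n in Sp, Sq. intro n.
    apply times_diff_plus; apply (times_diff_mult n (fun _ => _));
      auto using times_diff_const.
  - exists (M + N). intros x Hx. rewrite VM, VN by lra. ring.
Qed.

Lemma vanishes_outside_translate (s M : R) (phi : R -> R) :
  vanishes_outside M phi -> vanishes_outside (M + Rabs s) (translate s phi).
Proof.
  intros V x Hx. apply V. generalize (Rabs_triang (x - s) s).
  replace (x - s + s) with x by ring. lra.
Qed.

Lemma test_function_translate (s : R) (phi : R -> R) :
  test_function phi -> test_function (translate s phi).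
Proof.
  intros [S [M V]]. split.
  - apply smooth_iff_ex_derive_n. apply smooth_iff_ex_derive_n in S. intro n.
    replace (translate s phi) with (fun x => phi (1 * x + - s)); [now apply times_diff_affine|].
    apply functional_extensionality; intro x. unfold translate. f_equal. ring.
  - exists (M + Rabs s). now apply vanishes_outside_translate.
Qed.

(** The improper integral over the line stabilizes once the bounds have left the
    support. *)
Lemma dist_of_fun_RInt (F phi : R -> R) (M : R) : cont F -> cont phi -> 0 <= M ->
  vanishes_outside M phi -> dist_of_fun F phi = RInt (fun x => F x * phi x) (- M) M.
Proof.
  intros CF Cp M0 V. unfold dist_of_fun. apply is_RInt_gen_unique.
  unfold is_RInt_gen. apply filterlimi_locally. intro eps.
  apply Filter_prod with (fun a => a < - M) (fun b => M < b).
  - now exists (- M).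
  - now exists M.
  - intros a b Ha Hb. exists (RInt (fun x => F x * phi x) (- M) M). split; [|apply ball_center].
    rewrite <- (RInt_support _ a (- M) M b); auto with cont; try lra.
    + apply (RInt_correct (fun x => F x * phi x)). auto with cont.
    + intros x Hx. rewrite V; [ring|].
      destruct Hx as [Hx|Hx]; [rewrite Rabs_left by lra | rewrite Rabs_pos_eq by lra]; lra.
Qed.

(** The primitive of [psi] is again compactly supported exactly because the total
    integral of [psi] is 0.  This produces test functions with prescribed derivative. *)
Lemma test_function_primitive (psi : R -> R) (M : R) : smooth psi -> 0 <= M ->
  vanishes_outside M psi -> RInt psi (- M) M = 0 ->
  test_function (fun x => RInt psi (- M) x) /\ Derive (fun x => RInt psi (- M) x) = psi.
Proof.
  intros S M0 V I0.
  assert (C : cont psi).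
  { intro x. apply (ex_derive_continuous psi). exact (proj1 (S 1%nat) x). }
  assert (E : Derive (fun x => RInt psi (- M) x) = psi).
  { apply functional_extensionality; intro x. apply is_derive_unique.
    now apply is_derive_RInt_cont. }
  split; [|exact E]. split.
  - apply smooth_iff_ex_derive_n. intros [|n]; [exact I|]. split.
    + intro x. eexists. now apply is_derive_RInt_cont.
    + rewrite E. apply S.
  - exists M. intros x Hx. destruct (Rle_lt_dec 0 x) as [P|P].
    + rewrite Rabs_pos_eq in Hx by exact P. rewrite <- I0.
      apply RInt_support; auto; try lra. intros y [Hy|Hy]; apply V.
      * rewrite Rabs_left; lra.
      * rewrite Rabs_pos_eq; lra.
    + rewrite Rabs_left in Hx by exact P.
      rewrite (RInt_ext psi (fun _ => 0)), RInt_const_R; [ring|].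
      intros y. rewrite Rmax_left by lra. intros Hy. apply V. rewrite Rabs_left; lra.
Qed.

(** * Uniqueness of the primitive *)

Lemma cont_bump (c eps : R) : cont (bump c eps).
Proof.
  intro x. apply (ex_derive_continuous (bump c eps)).
  exact (proj1 (smooth_bump c eps 1%nat) x).
Qed.

#[local] Hint Resolve cont_bump : cont.

Lemma RInt_bump (c eps M : R) : 0 < eps -> Rabs c + eps <= M ->
  RInt (bump c eps) (- M) M = RInt (bump 0 eps) (- eps) eps.
Proof.
  intros He HM. assert (Hc := Rabs_maj2 c). assert (Hc' := Rle_abs c).
  rewrite (RInt_support (bump c eps) (- M) (- eps + c) (eps + c) M); auto with cont; try lra.
  - rewrite <- RInt_shift by auto with cont. apply RInt_ext. intros x _.
    rewrite bump_shift. f_equal. ring.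
  - intros x [Hx|Hx]; apply bump_outside; [rewrite Rabs_left by lra | rewrite Rabs_pos_eq by lra]; lra.
Qed.

(** Integration against a narrow bump at [c] is, up to the mass of the bump, evaluation
    at [c]. *)
Lemma bump_average (H : R -> R) (c eps eta M : R) : cont H -> 0 < eps ->
  Rabs c + eps <= M -> (forall x, Rabs (x - c) < eps -> Rabs (H x - H c) <= eta) ->
  Rabs (RInt (fun x => H x * bump c eps x) (- M) M - H c * RInt (bump 0 eps) (- eps) eps)
    <= eta * RInt (bump 0 eps) (- eps) eps.
Proof.
  intros CH He HM Hx. assert (Hc := Rabs_pos c).
  rewrite <- (RInt_bump c eps M) by assumption.
  rewrite <- !RInt_scal_cont, <- RInt_minus_cont by auto with cont.
  eapply Rle_trans; [apply abs_RInt_le; [lra | auto 6 with cont]|].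
  apply RInt_le; auto 7 with cont; [lra|]. intros x _.
  rewrite <- Rmult_minus_distr_r, Rabs_mult, (Rabs_pos_eq (bump _ _ _)) by apply bump_ge_0.
  destruct (Rlt_le_dec (Rabs (x - c)) eps) as [L|L].
  - apply Rmult_le_compat_r; [apply bump_ge_0 | now apply Hx].
  - rewrite bump_outside by exact L. lra.
Qed.

Lemma continuous_eps (f : R -> R) (x eps : R) : continuous f x -> 0 < eps ->
  exists d, 0 < d /\ forall y, Rabs (y - x) < d -> Rabs (f y - f x) < eps.
Proof.
  intros H He. destruct (proj1 (filterlim_locally f (f x)) H (mkposreal eps He)) as [d Hd].
  exists d. split; [apply cond_pos|]. intros y Hy. apply (Hd y Hy).
Qed.

(** The lemma of du Bois-Reymond.  A bump at [a] minus the same bump at [b] has total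
    integral 0, hence is the derivative of a test function and is annihilated by [H]; if the
    bumps are narrow this compares [H a] with [H b]. *)
Lemma zero_derivative_constant (H : R -> R) : cont H ->
  (forall phi, test_function phi -> dist_of_fun H (Derive phi) = 0) ->
  forall a b, H a = H b.
Proof.
  intros CH Z a b. destruct (Req_dec (H a) (H b)) as [E|E]; [exact E|exfalso].
  assert (Hd : 0 < Rabs (H a - H b) / 3).
  { generalize (Rabs_pos_lt (H a - H b)). lra. }
  destruct (continuous_eps H a _ (CH a) Hd) as [ea [Hea Ha]].
  destruct (continuous_eps H b _ (CH b) Hd) as [eb [Heb Hb]].
  set (e := Rmin ea eb). assert (He : 0 < e) by now apply Rmin_pos.
  assert (Lea : e <= ea) by apply Rmin_l. assert (Leb : e <= eb) by apply Rmin_r.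
  set (M := Rabs a + Rabs b + e).
  assert (Pa := Rabs_pos a). assert (Pb := Rabs_pos b).
  assert (Ma : Rabs a + e <= M) by (unfold M; lra).
  assert (Mb : Rabs b + e <= M) by (unfold M; lra).
  assert (M0 : 0 <= M) by (unfold M; lra).
  set (psi := fun x => bump a e x + (-1) * bump b e x).
  assert (S : smooth psi).
  { intro n. apply times_diff_plus; [apply smooth_bump|].
    apply (times_diff_mult n (fun _ => -1)); [apply times_diff_const | apply smooth_bump]. }
  assert (V : vanishes_outside M psi).
  { intros x Hx. unfold psi. rewrite !bump_outside; [ring| |].
    - generalize (Rabs_triang_inv x b). lra.
    - generalize (Rabs_triang_inv x a). lra. }
  assert (I0 : RInt psi (- M) M = 0).
  { unfold psi. rewrite RInt_plus_cont, RInt_scal_cont by auto with cont.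
    rewrite (RInt_bump a e M), (RInt_bump b e M) by assumption. Rring. }
  destruct (test_function_primitive psi M S M0 V I0) as [T D].
  specialize (Z _ T). rewrite D in Z.
  rewrite (dist_of_fun_RInt H psi M) in Z; auto; [|unfold psi; auto with cont].
  unfold psi in Z.
  rewrite (RInt_ext _ (fun x => H x * bump a e x - H x * bump b e x)) in Z
    by (intros; Rring).
  rewrite RInt_minus_cont in Z by auto with cont.
  assert (I : 0 < RInt (bump 0 e) (- e) e).
  { apply RInt_gt_0; [lra | | intros; apply cont_bump].
    intros x Hx. apply bump_pos. rewrite Rminus_0_r. apply Rabs_def1; lra. }
  assert (Aa : forall x, Rabs (x - a) < e -> Rabs (H x - H a) <= Rabs (H a - H b) / 3).
  { intros x Hx. apply Rlt_le, Ha. lra. }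
  assert (Ab : forall x, Rabs (x - b) < e -> Rabs (H x - H b) <= Rabs (H a - H b) / 3).
  { intros x Hx. apply Rlt_le, Hb. lra. }
  apply (bump_average H a e _ M CH He Ma) in Aa.
  apply (bump_average H b e _ M CH He Mb) in Ab.
  set (J := RInt (bump 0 e) (- e) e : R) in *.
  assert (L : Rabs ((H a - H b) * J) <= 2 * (Rabs (H a - H b) / 3) * J).
  { apply Rle_trans with
      (Rabs (RInt (fun x => H x * bump b e x) (- M) M - H b * J) +
       Rabs (RInt (fun x => H x * bump a e x) (- M) M - H a * J)); [|lra].
    rewrite <- (Rabs_Ropp (_ - H a * J)).
    eapply Rle_trans; [|apply Rabs_triang]. apply Req_le. f_equal. lra. }
  rewrite Rabs_mult, (Rabs_pos_eq J) in L by lra. nra.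
Qed.

Lemma dist_deriv_of_fun (F phi : R -> R) (M : R) : cont F -> test_function phi ->
  0 <= M -> vanishes_outside M phi ->
  dist_deriv (dist_of_fun F) phi = - RInt (fun x => F x * Derive phi x) (- M) M.
Proof.
  intros CF T M0 V. unfold dist_deriv. f_equal. apply dist_of_fun_RInt; auto.
  - now apply test_function_cont, test_function_Derive.
  - now apply vanishes_outside_Derive.
Qed.

Lemma is_primitive_unique (f : functional) (F G : R -> R) :
  is_primitive f F -> is_primitive f G -> F = G.
Proof.
  intros [[CF [F0 _]] EF] [[CG [G0 _]] EG]. apply functional_extensionality; intro x.
  cut (F x - G x = F (- PI) - G (- PI)); [lra|].
  apply (zero_derivative_constant (fun x => F x - G x)).
  - apply cont_minus; assumption.
  - intros phi T. destruct (test_function_support _ T) as [M [M0 V]].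
    specialize (EF _ T). specialize (EG _ T). rewrite EF in EG.
    rewrite !(dist_deriv_of_fun _ _ M) in EG by assumption.
    assert (T' := test_function_cont _ (test_function_Derive _ T)).
    rewrite (dist_of_fun_RInt _ _ M); auto with cont; [|now apply vanishes_outside_Derive].
    rewrite (RInt_ext _ (fun x => F x * Derive phi x - G x * Derive phi x)) by (intros; Rring).
    rewrite RInt_minus_cont; auto with cont. lra.
Qed.

(** The primitive attached to [f] is chosen arbitrarily; uniqueness identifies it. *)
Lemma primitive_eq (f : functional) (F : R -> R) : is_primitive f F -> Defs.primitive f = F.
Proof.
  intro H. apply (is_primitive_unique f); [|exact H].
  unfold Defs.primitive. apply epsilon_spec. now exists F.
Qed.

(** * Riemann-Stieltjes integrals with a C^1 integrator *)

Lemma RS_sum_cons (F g : R -> R) (h : R * R) (s : SF_seq (T := R)) :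
  RS_sum F g (SF_cons h s) = F (snd h) * (g (SF_h s) - g (fst h)) + RS_sum F g s.
Proof. destruct s as [x t]. destruct t; reflexivity. Qed.

(** On each cell the increment of [g] is [dg xi * (y - x)] up to [eta * (y - x)], and the
    errors add up to at most [K * eta] times the length of the interval. *)
Lemma RS_sum_close (F g dg : R -> R) (a b K eta d : R) :
  (forall x, a <= x <= b -> Rabs (F x) <= K) ->
  (forall x xi y, a <= x -> x <= xi <= y -> y <= b -> y - x < d ->
     Rabs (g y - g x - dg xi * (y - x)) <= eta * (y - x)) ->
  forall s : SF_seq (T := R), pointed_subdiv s -> seq_step (SF_lx s) < d ->
    a <= SF_h s -> seq.last (SF_h s) (SF_lx s) <= b ->
    SF_h s <= seq.last (SF_h s) (SF_lx s) /\
    Rabs (RS_sum F g s - Riemann_sum (fun x => F x * dg x) s)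
      <= K * eta * (seq.last (SF_h s) (SF_lx s) - SF_h s).
Proof.
  intros HF Hg s. induction s as [x | [x xi] s IH] using SF_cons_ind; intros P D A B.
  - cbn. split; [lra|]. change (Rabs (0 - 0) <= K * eta * (x - x)).
    rewrite Rminus_0_r, Rabs_R0. lra.
  - assert (P0 : x <= xi <= SF_h s) by exact (P O (Nat.lt_0_succ _)).
    change (seq_step (SF_lx (SF_cons (x, xi) s)))
      with (Rmax (Rabs (SF_h s - x)) (seq_step (SF_lx s))) in D.
    change (seq.last (SF_h (SF_cons (x, xi) s)) (SF_lx (SF_cons (x, xi) s)))
      with (seq.last (SF_h s) (SF_lx s)) in *.
    change (SF_h (SF_cons (x, xi) s)) with x in *.
    assert (D1 := Rmax_l (Rabs (SF_h s - x)) (seq_step (SF_lx s))).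
    assert (D2 := Rmax_r (Rabs (SF_h s - x)) (seq_step (SF_lx s))).
    assert (D3 := Rle_abs (SF_h s - x)).
    destruct IH as [L IH]; [now apply ptd_cons in P | lra | lra | exact B |].
    split; [lra|].
    rewrite RS_sum_cons, Riemann_sum_cons. cbn [fst snd].
    change (scal (SF_h s - x) (F xi * dg xi)) with ((SF_h s - x) * (F xi * dg xi)).
    change (plus ((SF_h s - x) * (F xi * dg xi)) (Riemann_sum (fun x => F x * dg x) s))
      with ((SF_h s - x) * (F xi * dg xi) + Riemann_sum (fun x => F x * dg x) s).
    set (U := RS_sum F g s) in *. set (V := Riemann_sum (fun x => F x * dg x) s : R) in *.
    set (l := seq.last (SF_h s) (SF_lx s)) in *. set (y := SF_h s) in *.
    replace (F xi * (g y - g x) + U - ((y - x) * (F xi * dg xi) + V))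
      with (F xi * (g y - g x - dg xi * (y - x)) + (U - V)) by ring.
    eapply Rle_trans; [apply Rabs_triang|]. rewrite Rabs_mult.
    replace (K * eta * (l - x)) with (K * (eta * (y - x)) + K * eta * (l - y)) by ring.
    apply Rplus_le_compat; [|exact IH].
    apply Rmult_le_compat; try apply Rabs_pos; [apply HF; lra|]. apply Hg; lra.
Qed.

(** By the mean value theorem the increment of [g] is [dg c * (y - x)] with [c] in the cell,
    and [dg] is uniformly continuous. *)
Lemma unif_linear (g dg : R -> R) (a b eta : R) :
  (forall x, is_derive g x (dg x)) -> cont dg -> 0 < eta ->
  exists d, 0 < d /\ forall x xi y, a <= x -> x <= xi <= y -> y <= b -> y - x < d ->
    Rabs (g y - g x - dg xi * (y - x)) <= eta * (y - x).
Proof.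
  intros D C He.
  destruct (unifcont_normed_1d dg a b (fun x _ => C x) (mkposreal _ He)) as [d Hd].
  exists d. split; [apply cond_pos|]. intros x xi y Hx Hxi Hy Hxy.
  destruct (MVT_gen g x y dg) as [c [Hc E]].
  - intros; apply D.
  - intros z _. apply continuity_pt_filterlim, (ex_derive_continuous g). eexists; apply D.
  - rewrite Rmin_left, Rmax_right in Hc by lra. rewrite E.
    replace (dg c * (y - x) - dg xi * (y - x)) with ((dg c - dg xi) * (y - x)) by ring.
    rewrite Rabs_mult, (Rabs_pos_eq (y - x)) by lra. apply Rmult_le_compat_r; [lra|].
    apply Rlt_le. apply (Hd xi c); [lra | lra |].
    change (Rabs (c - xi) < d). apply Rabs_def1; lra.
Qed.

Lemma cont_bounded (F : R -> R) (a b : R) : cont F ->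
  exists K, 0 < K /\ forall x, a <= x <= b -> Rabs (F x) <= K.
Proof.
  intro C. destruct (bounded_continuity F a b (fun x _ => C x)) as [K HK].
  exists (Rabs K + 1). split; [generalize (Rabs_pos K); lra|].
  intros x Hx. specialize (HK x Hx). change (Rabs (F x) < K) in HK.
  generalize (Rle_abs K). lra.
Qed.

Lemma is_RSInt_C1 (F g dg : R -> R) (a b : R) : a < b -> cont F ->
  (forall x, is_derive g x (dg x)) -> cont dg ->
  is_RSInt F g a b (RInt (fun x => F x * dg x) a b).
Proof.
  intros Hab CF D C. unfold is_RSInt. apply filterlim_locally. intro eps.
  assert (I := RInt_correct (fun x => F x * dg x) a b ltac:(auto with cont)).
  assert (He : 0 < eps / 2) by (generalize (cond_pos eps); lra).
  pose proof (proj1 (filterlim_locally _ _) I (mkposreal _ He)) as I'. clear I. rename I' into I.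
  destruct (cont_bounded F a b CF) as [K [HK BK]].
  (* With this [eta] the Stieltjes and Riemann sums differ by at most [eps / 4]. *)
  set (eta := eps / (4 * K * (b - a))).
  assert (Heta : 0 < eta).
  { apply Rdiv_lt_0_compat; [apply cond_pos|].
    apply Rmult_lt_0_compat; [lra|lra]. }
  destruct (unif_linear g dg a b eta D C Heta) as [d [Hd BL]].
  assert (N : Riemann_fine a b (fun s => pointed_subdiv s /\ SF_h s = Rmin a b /\
     seq.last (SF_h s) (SF_lx s) = Rmax a b /\ seq_step (SF_lx s) < d)).
  { exists (mkposreal _ Hd). intros s Hs [H1 [H2 H3]]. exact (conj H1 (conj H2 (conj H3 Hs))). }
  generalize (filter_and _ _ I N). apply filter_imp. clear I N.
  intros s [I [P [Ha [Hb S]]]]. rewrite Rmin_left in Ha by lra. rewrite Rmax_right in Hb by lra.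
  destruct (RS_sum_close F g dg a b K eta d BK BL s P S) as [_ Q]; [lra|lra|].
  rewrite sign_eq_1 in I by lra.
  set (J := RInt (fun x => F x * dg x) a b : R) in *.
  set (V := Riemann_sum (fun x => F x * dg x) s : R) in *.
  change (Rabs (1 * V - J) < eps / 2) in I. change (Rabs (RS_sum F g s - J) < eps).
  rewrite Hb, Ha in Q.
  replace (K * eta * (b - a)) with (eps / 4) in Q by (unfold eta; field; lra).
  replace (RS_sum F g s - J) with ((RS_sum F g s - V) + (1 * V - J)) by ring.
  eapply Rle_lt_trans; [apply Rabs_triang|]. generalize (cond_pos eps). lra.
Qed.

Lemma RSInt_C1 (F g dg : R -> R) (a b : R) : a < b -> cont F ->
  (forall x, is_derive g x (dg x)) -> cont dg ->
  RSInt F g a b = RInt (fun x => F x * dg x) a b.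
Proof.
  intros Hab CF D C. unfold RSInt, is_RSInt.
  apply (iota_filterlim_locally (V := R_CompleteNormedModule)).
  now apply is_RSInt_C1.
Qed.

(** * Functions that grow by a constant over each period *)

Lemma reduce_mod_2PI (y : R) : exists (m : Z) (z : R), - PI <= z < PI /\ y = z + 2 * IZR m * PI.
Proof.
  assert (HP := PI_RGT_0).
  (* The number of whole periods between [-PI] and [y]. *)
  exists (Int_part ((y + PI) / (2 * PI))), (y - 2 * IZR (Int_part ((y + PI) / (2 * PI))) * PI).
  destruct (base_Int_part ((y + PI) / (2 * PI))) as [H1 H2].
  set (m := IZR (Int_part ((y + PI) / (2 * PI)))) in *. split; [|ring].
  assert (E : y + PI = (y + PI) / (2 * PI) * (2 * PI)) by (field; lra).
  apply (Rmult_le_compat_r (2 * PI)) in H1; [|lra].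
  assert (H3 : (y + PI) / (2 * PI) < m + 1) by lra.
  apply (Rmult_lt_compat_r (2 * PI)) in H3; [|lra].
  lra.
Qed.

Lemma Bc_shift (F : R -> R) (y : R) (m : Z) : Bc F -> F (y + 2 * IZR m * PI) = F y + IZR m * F PI.
Proof.
  intros [_ [_ H]]. destruct (reduce_mod_2PI y) as [k [z [Hz ->]]].
  replace (z + 2 * IZR k * PI + 2 * IZR m * PI) with (z + 2 * IZR (k + m) * PI)
    by (rewrite plus_IZR; ring).
  rewrite !H, plus_IZR by exact Hz. ring.
Qed.

Lemma Bc_period (F : R -> R) (y : R) : Bc F -> F (y + 2 * PI) = F y + F PI.
Proof.
  intro H. generalize (Bc_shift F y 1 H). rewrite !Rmult_1_r, Rmult_1_l. auto.
Qed.

(** Quasi-periodicity over one period, at every point, suffices: the integer multiples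
    follow by induction in both directions. *)
Lemma Bc_intro (F : R -> R) : cont F -> F (- PI) = 0 ->
  (forall y, F (y + 2 * PI) = F y + F PI) -> Bc F.
Proof.
  intros C F0 P. split; [exact C|]. split; [exact F0|]. intros y n _. revert y.
  assert (N : forall (m : nat) y, F (y + 2 * IZR (Z.of_nat m) * PI) = F y + IZR (Z.of_nat m) * F PI).
  { induction m as [|m IH]; intro y; [simpl; rewrite Rmult_0_r, !Rmult_0_l, !Rplus_0_r; reflexivity|].
    rewrite Nat2Z.inj_succ, succ_IZR.
    replace (y + 2 * (IZR (Z.of_nat m) + 1) * PI) with ((y + 2 * PI) + 2 * IZR (Z.of_nat m) * PI) by ring.
    rewrite IH, P. ring. }
  intro y. destruct (Z.le_ge_cases 0 n) as [Hn|Hn].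
  - rewrite <- (Z2Nat.id n) by exact Hn. apply N.
  - specialize (N (Z.to_nat (- n)) (y + 2 * IZR n * PI)).
    rewrite Z2Nat.id, opp_IZR in N by lia.
    replace (y + 2 * IZR n * PI + 2 * - IZR n * PI) with y in N by ring. lra.
Qed.

(** Translation by a multiple of the period does not change the increments of [F], so a
    single compact interval is enough. *)
Lemma Bc_bounded_increments (F : R -> R) : Bc F ->
  exists K, forall a b, a <= b -> b - a <= 2 * PI -> Rabs (F b - F a) <= K.
Proof.
  intro H. assert (HP := PI_RGT_0).
  destruct (cont_bounded F (- PI) (3 * PI) (proj1 H)) as [K [_ B]].
  exists (K + K). intros a b Hab Hl.
  destruct (reduce_mod_2PI a) as [m [z [Hz ->]]].
  replace b with (b - 2 * IZR m * PI + 2 * IZR m * PI) in * by ring.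
  set (w := b - 2 * IZR m * PI) in *.
  rewrite !Bc_shift by exact H.
  replace (F w + _ - _) with (F w + - F z) by ring.
  eapply Rle_trans; [apply Rabs_triang|]. rewrite Rabs_Ropp.
  apply Rplus_le_compat; apply B; lra.
Qed.

(** The increments of [F] are invariant under translation by the period, so Heine's theorem
    on a compact interval longer than a period applies. *)
Lemma Bc_uniformly_continuous (F : R -> R) (eps : R) : Bc F -> 0 < eps ->
  exists d, 0 < d /\ forall x y, Rabs (x - y) < d -> Rabs (F x - F y) < eps.
Proof.
  intros H He. assert (HP := PI_RGT_0).
  destruct (unifcont_normed_1d F (- (2 * PI)) (2 * PI) (fun x _ => proj1 H x) (mkposreal _ He))
    as [d Hd].
  (* Within distance [PI] of a point of [[- PI, PI)] one stays in [[- 2 PI, 2 PI]]. *)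
  exists (Rmin d PI). split; [apply Rmin_pos; [apply cond_pos | exact HP]|].
  intros x y Hxy. destruct (reduce_mod_2PI y) as [m [z [Hz ->]]].
  replace x with (x - 2 * IZR m * PI + 2 * IZR m * PI) in * by ring.
  set (w := x - 2 * IZR m * PI) in *. rewrite !Bc_shift by exact H.
  replace (F w + _ - _) with (F w - F z) by ring.
  replace (w + 2 * IZR m * PI - (z + 2 * IZR m * PI)) with (w - z) in Hxy by ring.
  assert (L1 := Rmin_l d PI). assert (L2 := Rmin_r d PI).
  assert (L := Hxy). apply Rabs_def2 in L.
  apply (Hd z w); [lra|lra|]. change (Rabs (w - z) < d). lra.
Qed.

(** * Operations on primitives *)

Lemma is_primitive_plus (f g : functional) (F G : R -> R) :
  is_primitive f F -> is_primitive g G -> is_primitive (dist_plus f g) (fun x => F x + G x).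
Proof.
  intros [BF EF] [BG EG]. assert (CF : cont F) by exact (proj1 BF).
  assert (CG : cont G) by exact (proj1 BG).
  split.
  - apply Bc_intro; auto with cont.
    + destruct BF as [_ [-> _]], BG as [_ [-> _]]. ring.
    + intro y. rewrite !Bc_period by assumption. ring.
  - intros phi T. destruct (test_function_support _ T) as [M [M0 V]].
    unfold dist_plus. rewrite EF, EG by exact T.
    rewrite !(dist_deriv_of_fun _ phi M) by auto with cont.
    assert (T' := test_function_cont _ (test_function_Derive _ T)).
    rewrite (RInt_ext (fun x => (F x + G x) * _) (fun x => F x * Derive phi x + G x * Derive phi x))
      by (intros; Rring).
    rewrite RInt_plus_cont by auto with cont. ring.
Qed.

Lemma is_primitive_scal (c : R) (f : functional) (F : R -> R) :
  is_primitive f F -> is_primitive (fun phi => c * f phi) (fun x => c * F x).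
Proof.
  intros [BF EF]. assert (CF : cont F) by exact (proj1 BF). split.
  - apply Bc_intro; auto with cont.
    + destruct BF as [_ [-> _]]. ring.
    + intro y. rewrite !Bc_period by assumption. ring.
  - intros phi T. destruct (test_function_support _ T) as [M [M0 V]].
    rewrite EF by exact T. rewrite !(dist_deriv_of_fun _ phi M) by auto with cont.
    assert (T' := test_function_cont _ (test_function_Derive _ T)).
    rewrite (RInt_ext (fun x => c * F x * _) (fun x => c * (F x * Derive phi x))) by (intros; Rring).
    rewrite RInt_scal_cont by auto with cont. ring.
Qed.

Lemma is_primitive_ext (f g : functional) (F : R -> R) :
  dist_eq f g -> is_primitive f F -> is_primitive g F.
Proof. intros E [B H]. split; [exact B|]. intros phi T. rewrite <- E by exact T. now apply H. Qed.

Lemma is_primitive_minus (f g : functional) (F G : R -> R) :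
  is_primitive f F -> is_primitive g G -> is_primitive (dist_minus f g) (fun x => F x - G x).
Proof.
  intros HF HG. apply (is_primitive_scal (-1)) in HG.
  apply is_primitive_ext with (dist_plus f (fun phi => -1 * g phi)).
  - intros phi _. unfold dist_plus, dist_minus. ring.
  - replace (fun x => F x - G x) with (fun x => F x + -1 * G x);
      [now apply is_primitive_plus|].
    apply functional_extensionality; intro x. ring.
Qed.

Lemma Derive_translate (s : R) (phi : R -> R) (x : R) : test_function phi ->
  Derive (translate s phi) x = Derive phi (x - s).
Proof.
  intro T. apply is_derive_unique. unfold translate.
  assert (D := test_function_is_derive phi (x - s) T).
  auto_derive; [exact (ex_intro _ _ D)|].
  change (Derive (fun x => phi x)) with (Derive phi). unfold Rminus; ring.
Qed.

Lemma RInt_Derive_test (phi : R -> R) (M : R) : test_function phi ->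
  vanishes_outside M phi -> 0 <= M -> RInt (Derive phi) (- (M + 1)) (M + 1) = 0.
Proof.
  intros T V M0. rewrite (RInt_of_derivative phi (Derive phi)).
  - rewrite !V; [Rring | |]; [rewrite Rabs_left | rewrite Rabs_pos_eq]; lra.
  - intro; now apply test_function_is_derive.
  - now apply test_function_cont, test_function_Derive.
Qed.

(** The translate of [F] is renormalized to vanish at [-PI]; the constant is invisible to
    derivatives of test functions. *)
Lemma is_primitive_translate (s : R) (f : functional) (F : R -> R) : is_primitive f F ->
  is_primitive (dist_translate s f) (fun x => F (x - s) - F (- PI - s)).
Proof.
  intros [BF EF]. assert (CF : cont F) by exact (proj1 BF).
  assert (CFs : cont (fun x => F (x - s))).
  { apply (cont_comp F (fun x => x - s)); auto with cont. }
  split.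
  - apply Bc_intro; auto with cont; [ring|]. intro y.
    replace (y + 2 * PI - s) with (y - s + 2 * PI) by ring.
    replace (PI - s) with (- PI - s + 2 * PI) by ring.
    rewrite !Bc_period by exact BF. ring.
  - intros phi T. destruct (test_function_support _ T) as [M [M0 V]].
    assert (Ps := Rabs_pos s).
    (* Both integration intervals must contain the supports, translated by [s] and with a
       margin of 1 so that the test function vanishes at the end points. *)
    set (N := M + 1 + Rabs s).
    unfold dist_translate. rewrite EF by now apply test_function_translate.
    rewrite (dist_deriv_of_fun _ _ (N + Rabs s)); auto.
    2: now apply test_function_translate.
    2: unfold N; lra.
    2: { apply vanishes_outside_weaken with (M + Rabs (- s)).
         - rewrite Rabs_Ropp. unfold N. lra.
         - now apply vanishes_outside_translate. }
    rewrite (dist_deriv_of_fun _ phi (M + 1)); auto with cont; [| lra |].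
    2: { apply vanishes_outside_weaken with (2 := V). lra. }
    assert (T' := test_function_cont _ (test_function_Derive _ T)).
    f_equal.
    rewrite (RInt_ext (fun x => (F (x - s) - _) * _)
       (fun x => F (x - s) * Derive phi x - F (- PI - s) * Derive phi x)) by (intros; Rring).
    rewrite RInt_minus_cont, (RInt_scal_cont _ (Derive phi)), (RInt_Derive_test phi M)
      by auto with cont.
    rewrite Rmult_0_r, Rminus_0_r.
    transitivity (RInt (fun x => (fun u => F (u - s) * Derive phi u) (x + s))
      (- (N + Rabs s)) (N + Rabs s)).
    + apply RInt_ext. intros x _. cbn beta. rewrite Derive_translate by exact T.
      f_equal; f_equal; ring.
    + etransitivity; [apply (RInt_shift (fun u => F (u - s) * Derive phi u) s); auto with cont|].
      assert (Hs := Rle_abs s). assert (Hs' := Rle_abs (- s)). rewrite Rabs_Ropp in Hs'.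
      apply (RInt_support (fun u => F (u - s) * Derive phi u)); unfold N; auto with cont; try lra.
      intros x Hx. rewrite (vanishes_outside_Derive M phi V); [ring|].
      destruct Hx; [rewrite Rabs_left by lra | rewrite Rabs_pos_eq by lra]; lra.
Qed.

(** * Pairing with a wave *)

(** The continuous primitive integral of [F'] times [cos(n t + th)], integrated by parts.
    Keeping the phase [th] free treats the real part, the imaginary part and all rotated
    coefficients at once. *)
Definition coef (F : R -> R) (n : Z) (th : R) : R :=
  F PI * cos (IZR n * PI + th)
  + IZR n * RInt (fun t => F t * sin (IZR n * t + th)) (- PI) PI.

Lemma is_derive_cos_wave (n th t : R) :
  is_derive (fun t => cos (n * t + th)) t (- n * sin (n * t + th)).
Proof. auto_derive; [exact I | ring]. Qed.

Lemma is_derive_sin_wave (n th t : R) :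
  is_derive (fun t => sin (n * t + th)) t (n * cos (n * t + th)).
Proof. auto_derive; [exact I | ring]. Qed.

Lemma cont_cos_wave (n th : R) : cont (fun t => cos (n * t + th)).
Proof. apply cont_derivable with (1 := is_derive_cos_wave n th). Qed.

Lemma cont_sin_wave (n th : R) : cont (fun t => sin (n * t + th)).
Proof. apply cont_derivable with (1 := is_derive_sin_wave n th). Qed.

#[local] Hint Resolve cont_cos_wave cont_sin_wave : cont.

Lemma cp_int_mult_cos (f : functional) (F : R -> R) (n : Z) (th : R) : is_primitive f F ->
  cp_int_mult f (fun t => cos (IZR n * t + th)) = coef F n th.
Proof.
  intro H. assert (C : cont F) by exact (proj1 (proj1 H)). assert (HP := PI_RGT_0).
  unfold cp_int_mult. rewrite (primitive_eq f F H).
  rewrite (RSInt_C1 F (fun t => cos (IZR n * t + th)) (fun t => - IZR n * sin (IZR n * t + th)));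
    auto using is_derive_cos_wave with cont; [|lra].
  rewrite (RInt_ext _ (fun t => (- IZR n) * (F t * sin (IZR n * t + th)))) by (intros; Rring).
  rewrite RInt_scal_cont by auto with cont. unfold coef. ring.
Qed.

Lemma fourier_coef (f : functional) (F : R -> R) (n : Z) : is_primitive f F ->
  fourier f n = (coef F n 0, coef F n (PI / 2)).
Proof.
  intro H. unfold fourier, cp_int_Cmult.
  rewrite <- !(cp_int_mult_cos f F n _ H). f_equal; f_equal;
    apply functional_extensionality; intro t; cbn.
  - now rewrite cos_neg, Rplus_0_r.
  - rewrite sin_neg, sin_cos, Rplus_comm. ring.
Qed.

Lemma cos_shift_Z (x : R) (n : Z) : cos (x + 2 * IZR n * PI) = cos x.
Proof.
  destruct (Z.le_ge_cases 0 n) as [Hn|Hn].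
  - rewrite <- (Z2Nat.id n) by exact Hn. rewrite <- INR_IZR_INZ. apply cos_period.
  - rewrite <- (cos_period (_ + _) (Z.to_nat (- n))). f_equal.
    rewrite INR_IZR_INZ, Z2Nat.id, opp_IZR by lia. ring.
Qed.

Lemma sin_shift_Z (x : R) (n : Z) : sin (x + 2 * IZR n * PI) = sin x.
Proof. rewrite !sin_cos, <- Rplus_assoc, cos_shift_Z. reflexivity. Qed.

Lemma RInt_sin_wave (n : Z) (th a : R) :
  IZR n * RInt (fun t => sin (IZR n * t + th)) a (a + 2 * PI) = 0.
Proof.
  rewrite <- RInt_scal_cont by auto with cont.
  rewrite (RInt_of_derivative (fun t => - cos (IZR n * t + th))); auto with cont.
  - replace (IZR n * (a + 2 * PI) + th) with (IZR n * a + th + 2 * IZR n * PI) by ring.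
    rewrite cos_shift_Z. ring.
  - intro x. auto_derive; [exact I | ring].
Qed.

Lemma coef_plus (F G : R -> R) (n : Z) (th : R) : cont F -> cont G ->
  coef (fun x => F x + G x) n th = coef F n th + coef G n th.
Proof.
  intros. unfold coef.
  rewrite (RInt_ext (fun t => (F t + G t) * _)
    (fun t => F t * sin (IZR n * t + th) + G t * sin (IZR n * t + th))) by (intros; Rring).
  rewrite RInt_plus_cont by auto with cont. ring.
Qed.

Lemma coef_scal (c : R) (F : R -> R) (n : Z) (th : R) : cont F ->
  coef (fun x => c * F x) n th = c * coef F n th.
Proof.
  intros. unfold coef.
  rewrite (RInt_ext (fun t => c * F t * _) (fun t => c * (F t * sin (IZR n * t + th))))
    by (intros; Rring).
  rewrite RInt_scal_cont by auto with cont. ring.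
Qed.

(** The addition formula for [cos(n t + th + phi)]. *)
Lemma coef_rotate (F : R -> R) (n : Z) (th phi : R) : cont F ->
  coef F n (th + phi) = cos phi * coef F n th + sin phi * coef F n (th + PI / 2).
Proof.
  intro C. unfold coef.
  assert (Ec : forall x, cos (x + (th + PI / 2)) = - sin (x + th)).
  { intro x. rewrite sin_cos, Ropp_involutive. f_equal. ring. }
  assert (Es : forall x, sin (x + (th + PI / 2)) = cos (x + th)).
  { intro x. rewrite cos_sin. f_equal. ring. }
  rewrite (RInt_ext (fun t => F t * sin (IZR n * t + (th + phi)))
    (fun t => cos phi * (F t * sin (IZR n * t + th))
              + sin phi * (F t * sin (IZR n * t + (th + PI / 2))))).
  - rewrite RInt_plus_cont, !RInt_scal_cont by auto with cont.
    rewrite Ec, <- Rplus_assoc, cos_plus. ring.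
  - intros t _. rewrite Es, <- Rplus_assoc, sin_plus. Rring.
Qed.

Lemma coef_neg (F : R -> R) (n : Z) (th : R) : cont F -> coef F (- n) th = coef F n (- th).
Proof.
  intro C. unfold coef. rewrite opp_IZR.
  rewrite (RInt_ext _ (fun t => (-1) * (F t * sin (IZR n * t + - th)))).
  - rewrite RInt_scal_cont by auto with cont.
    replace (- IZR n * PI + th) with (- (IZR n * PI + - th)) by ring. rewrite cos_neg. ring.
  - intros t _. replace (- IZR n * t + th) with (- (IZR n * t + - th)) by ring.
    rewrite sin_neg. Rring.
Qed.

(** Since [F] grows by [F PI] per period, moving the start of the period of integration from
    [-PI] to [a] adds [F PI * (cos (n PI + th) - cos (n a + th))] to the integral term, which
    compensates for the change of the boundary term. *)
Lemma coef_base_point (F : R -> R) (n : Z) (th a : R) : Bc F ->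
  coef F n th = F PI * cos (IZR n * a + th)
    + IZR n * RInt (fun t => F t * sin (IZR n * t + th)) a (a + 2 * PI).
Proof.
  intros H. assert (C : cont F) by exact (proj1 H). unfold coef.
  set (h := fun t => F t * sin (IZR n * t + th)).
  assert (Ch : cont h) by (unfold h; auto with cont).
  rewrite <- (RInt_Chasles_cont h a (- PI) (a + 2 * PI)) by exact Ch.
  rewrite <- (RInt_Chasles_cont h (- PI) PI (a + 2 * PI)) by exact Ch.
  assert (E : RInt h PI (a + 2 * PI) =
    RInt h (- PI) a + F PI * RInt (fun t => sin (IZR n * t + th)) (- PI) a).
  { replace PI with (- PI + 2 * PI) at 1 by ring.
    rewrite <- RInt_shift, <- RInt_scal_cont, <- RInt_plus_cont by auto with cont.
    apply RInt_ext. intros t _. unfold h.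
    rewrite Bc_period by exact H.
    replace (IZR n * (t + 2 * PI) + th) with (IZR n * t + th + 2 * IZR n * PI) by ring.
    rewrite sin_shift_Z. Rring. }
  assert (A : RInt h a (- PI) + RInt h (- PI) a = 0).
  { rewrite RInt_Chasles_cont by exact Ch. exact (RInt_point a h). }
  assert (B : IZR n * RInt (fun t => sin (IZR n * t + th)) (- PI) a
     = cos (IZR n * PI + th) - cos (IZR n * a + th)).
  { rewrite <- RInt_scal_cont by auto with cont.
    rewrite (RInt_of_derivative (fun t => - cos (IZR n * t + th))); auto with cont.
    - rewrite <- (cos_shift_Z (IZR n * - PI + th) n).
      replace (IZR n * - PI + th + 2 * IZR n * PI) with (IZR n * PI + th) by ring. ring.
    - intro x. auto_derive; [exact I | ring]. }
  rewrite E.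
  replace (RInt h a (- PI)) with (- RInt h (- PI) a) by lra.
  apply Rminus_diag_uniq.
  set (S := RInt (fun t => sin (IZR n * t + th)) (- PI) a : R) in *.
  transitivity (F PI * (cos (IZR n * PI + th) - cos (IZR n * a + th) - IZR n * S)); [ring|].
  rewrite B. ring.
Qed.

(** Substitute [u = t - s]: the wave gets the phase [n s], and the period of integration
    becomes [[- PI - s, PI - s]], where [coef_base_point] applies.  The constant
    [F (- PI - s)] integrates to 0 against the wave. *)
Lemma coef_translate (F : R -> R) (n : Z) (th s : R) : Bc F ->
  coef (fun x => F (x - s) - F (- PI - s)) n th = coef F n (th + IZR n * s).
Proof.
  intros H. assert (C : cont F) by exact (proj1 H).
  assert (Cs : cont (fun t => F (t - s))) by (apply (cont_comp F (fun t => t - s)); auto with cont).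
  rewrite (coef_base_point F n _ (- PI - s) H). unfold coef.
  replace (PI - s) with (- PI - s + 2 * PI) at 1 by ring. rewrite Bc_period by exact H.
  f_equal.
  - replace (IZR n * (- PI - s) + (th + IZR n * s)) with (IZR n * - PI + th) by ring.
    rewrite <- (cos_shift_Z (IZR n * - PI + th) n).
    replace (IZR n * - PI + th + 2 * IZR n * PI) with (IZR n * PI + th) by ring. ring.
  - rewrite (RInt_ext _ (fun t => F (t - s) * sin (IZR n * t + th)
        - F (- PI - s) * sin (IZR n * t + th))) by (intros; Rring).
    rewrite RInt_minus_cont, RInt_scal_cont by auto with cont.
    rewrite Rmult_minus_distr_l.
    generalize (RInt_sin_wave n th (- PI)). replace (- PI + 2 * PI) with PI by ring.
    set (S := RInt (fun t => sin (IZR n * t + th)) (- PI) PI : R). intro ES.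
    replace (IZR n * (F (- PI - s) * S)) with (F (- PI - s) * (IZR n * S)) by ring.
    rewrite ES, Rmult_0_r, Rminus_0_r. f_equal.
    replace (- PI - s) with (- PI + - s) at 1 by ring.
    replace (- PI - s + 2 * PI) with (PI + - s) by ring.
    rewrite <- (RInt_shift (fun t => F t * sin (IZR n * t + (th + IZR n * s)))) by auto with cont.
    apply RInt_ext. intros t _. cbn beta.
    replace (IZR n * (t + - s) + (th + IZR n * s)) with (IZR n * t + th) by ring. reflexivity.
Qed.

Lemma polar (a b : R) : exists phi, sqrt (a ^ 2 + b ^ 2) = cos phi * a + sin phi * b.
Proof.
  set (r := sqrt (a ^ 2 + b ^ 2)).
  assert (P : 0 <= a ^ 2 + b ^ 2) by (generalize (pow2_ge_0 a) (pow2_ge_0 b); lra).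
  assert (R2 : r * r = a ^ 2 + b ^ 2) by now apply sqrt_def.
  destruct (Req_dec r 0) as [Z|Z].
  - exists 0. rewrite Z, cos_0, sin_0. assert (a ^ 2 = 0).
    { generalize (pow2_ge_0 a) (pow2_ge_0 b). rewrite Z in R2. lra. }
    assert (a = 0) by (apply Rsqr_0_uniq; unfold Rsqr; lra). lra.
  - assert (r0 : 0 < r) by (generalize (sqrt_pos (a ^ 2 + b ^ 2)); fold r; lra).
    assert (Hc : -1 <= a / r <= 1).
    { split; [apply Rle_div_r | apply Rle_div_l]; try exact r0; nra. }
    assert (E : sqrt (1 - (a / r)²) = Rabs b / r).
    { rewrite <- (sqrt_Rsqr (Rabs b / r)).
      - f_equal. unfold Rsqr.
        replace (Rabs b / r * (Rabs b / r)) with (Rabs b ^ 2 / (r * r)) by (field; lra).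
        rewrite pow2_abs. replace (b ^ 2) with (r * r - a ^ 2) by lra. field. lra.
      - apply Rmult_le_pos; [apply Rabs_pos|]. apply Rlt_le, Rinv_0_lt_compat; lra. }
    assert (F : r = a / r * a + b / r * b).
    { apply Rmult_eq_reg_r with r; [|lra]. rewrite R2. field. lra. }
    destruct (Rle_lt_dec 0 b) as [Hb|Hb].
    + exists (acos (a / r)). rewrite cos_acos, sin_acos, E, (Rabs_pos_eq b) by assumption.
      exact F.
    + exists (- acos (a / r)).
      rewrite cos_neg, sin_neg, cos_acos, sin_acos, E, (Rabs_left b) by assumption.
      rewrite F at 1. field. lra.
Qed.

(** Rotating the complex number onto the positive real axis. *)
Lemma Cmod_fourier_coef (f : functional) (F : R -> R) (n : Z) : is_primitive f F ->
  exists phi, Cmod (fourier f n) = coef F n phi.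
Proof.
  intro H. rewrite (fourier_coef f F n H).
  destruct (polar (coef F n 0) (coef F n (PI / 2))) as [phi E]. exists phi.
  unfold Cmod. cbn [fst snd]. rewrite E.
  generalize (coef_rotate F n 0 phi (proj1 (proj1 H))). rewrite !Rplus_0_l. auto.
Qed.

(** The supremum is finite, since the increments of the primitive over at most one period
    are bounded; hence taking its real value loses nothing. *)
Lemma alexiewicz_norm_spec (f : functional) (F : R -> R) : is_primitive f F ->
  (forall a b, a <= b -> b - a <= 2 * PI -> Rabs (F b - F a) <= alexiewicz_norm f) /\
  (forall c, (forall a b, a <= b -> b - a <= 2 * PI -> Rabs (F b - F a) <= c) ->
    alexiewicz_norm f <= c).
Proof.
  intro H. unfold alexiewicz_norm, cp_int. rewrite (primitive_eq f F H).
  set (E := fun r => exists a b, a <= b /\ b - a <= 2 * PI /\ r = Rabs (F b - F a)).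
  destruct (Lub_Rbar_correct E) as [U L].
  destruct (Bc_bounded_increments F (proj1 H)) as [K HK].
  assert (UK : forall c, (forall a b, a <= b -> b - a <= 2 * PI -> Rabs (F b - F a) <= c) ->
    Rbar_le (Lub_Rbar E) c).
  { intros c Hc. apply L. intros r [a [b [H1 [H2 ->]]]]. now apply Hc. }
  assert (E0 : E (Rabs (F 0 - F 0))).
  { exists 0, 0. assert (P := PI_RGT_0). repeat split; lra. }
  assert (W := U _ E0). assert (X := UK K HK).
  destruct (Lub_Rbar E) as [l | |]; try contradiction. cbn in *. split.
  - intros a b H1 H2. apply (U (Rabs (F b - F a))). now exists a, b.
  - exact UK.
Qed.

(** * The Alexiewicz norm estimate *)

(** The period is taken to start at a zero [a] of the wave, so that only
    [n * int (F - F a) sin(n t + th)] remains, with [|F - F a|] at most the norm.  The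
    integral of [|sin|] over a period is bounded by means of
    [sqrt 2 |s| <= 1/2 + s^2], which gives [sqrt 2 * PI]. *)
Lemma coef_le_norm (f : functional) (F : R -> R) (n : Z) (th : R) : is_primitive f F ->
  n <> 0%Z -> coef F n th <= Rabs (IZR n) * (sqrt 2 * PI * alexiewicz_norm f).
Proof.
  intros H Hn. assert (C : cont F) by exact (proj1 (proj1 H)).
  assert (HN : IZR n <> 0) by now apply not_0_IZR.
  assert (HP := PI_RGT_0).
  set (N := alexiewicz_norm f).
  assert (BN : forall a b, a <= b -> b - a <= 2 * PI -> Rabs (F b - F a) <= N)
    by apply (alexiewicz_norm_spec f F H).
  assert (N0 : 0 <= N).
  { eapply Rle_trans; [apply (Rabs_pos (F 0 - F 0)) | apply BN; lra]. }
  set (a := (PI / 2 - th) / IZR n).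
  rewrite (coef_base_point F n th a (proj1 H)).
  replace (IZR n * a + th) with (PI / 2) by (unfold a; field; exact HN).
  rewrite cos_PI2, Rmult_0_r, Rplus_0_l.
  set (S := fun t => sin (IZR n * t + th)).
  assert (CS : cont S) by (unfold S; auto with cont).
  replace (IZR n * RInt (fun t => F t * sin (IZR n * t + th)) a (a + 2 * PI))
    with (IZR n * RInt (fun t => (F t - F a) * S t) a (a + 2 * PI)).
  2: { rewrite (RInt_ext (fun t => (F t - F a) * S t) (fun t => F t * S t - F a * S t))
         by (intros; Rring).
       rewrite RInt_minus_cont, RInt_scal_cont by auto with cont.
       generalize (RInt_sin_wave n th a). fold S.
       set (U := RInt (fun t => F t * S t) a (a + 2 * PI) : R).
       set (V := RInt S a (a + 2 * PI) : R). intro Z.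
       replace (IZR n * (U - F a * V)) with (IZR n * U - F a * (IZR n * V)) by ring.
       rewrite Z. unfold U, S. ring. }
  eapply Rle_trans; [apply Rle_abs|]. rewrite Rabs_mult.
  apply Rmult_le_compat_l; [apply Rabs_pos|].
  eapply Rle_trans; [apply abs_RInt_le; [lra | auto with cont]|].
  assert (I2 : RInt (fun t => / 2 + S t * S t) a (a + 2 * PI) = 2 * PI).
  { rewrite (RInt_of_derivative (fun t => t - sin (2 * (IZR n * t + th)) / (4 * IZR n))).
    - replace (2 * (IZR n * (a + 2 * PI) + th))
        with (2 * (IZR n * a + th) + 2 * IZR (2 * n) * PI) by (rewrite mult_IZR; ring).
      rewrite sin_shift_Z. apply Rminus_diag_uniq. field. exact HN.
    - intro t. auto_derive; [exact I|]. unfold S.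
      rewrite cos_2a_sin. field. exact HN.
    - auto with cont. }
  assert (R2 : sqrt 2 * sqrt 2 = 2) by (apply sqrt_def; lra).
  assert (R0 : 0 < sqrt 2) by (apply sqrt_lt_R0; lra).
  apply Rle_trans with (RInt (fun t => N * / sqrt 2 * (/ 2 + S t * S t)) a (a + 2 * PI)).
  - apply RInt_le; auto 6 with cont; [lra|]. intros t Ht. rewrite Rabs_mult, Rmult_assoc.
    apply Rmult_le_compat; try apply Rabs_pos; [apply BN; lra|].
    apply Rmult_le_reg_l with (sqrt 2); [exact R0|].
    rewrite <- Rmult_assoc, Rinv_r, Rmult_1_l by lra.
    rewrite <- (Rabs_pos_eq (S t * S t)) by apply Rle_0_sqr. rewrite Rabs_mult.
    generalize (pow2_ge_0 (Rabs (S t) - sqrt 2 / 2)). simpl. nra.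
  - rewrite RInt_scal_cont, I2 by auto with cont.
    apply Rmult_le_reg_l with (sqrt 2); [exact R0|]. apply Req_le.
    transitivity (2 * PI * N); [field; lra|].
    transitivity (sqrt 2 * sqrt 2 * PI * N); [rewrite R2; ring | ring].
Qed.

Lemma fourier_le_norm (f : functional) (F : R -> R) (n : Z) : is_primitive f F ->
  n <> 0%Z -> Cmod (fourier f n) <= 4 * sqrt 2 * Rabs (IZR n) * alexiewicz_norm f.
Proof.
  intros H Hn. destruct (Cmod_fourier_coef f F n H) as [phi ->].
  eapply Rle_trans; [apply (coef_le_norm f F n phi H Hn)|].
  assert (N0 : 0 <= alexiewicz_norm f).
  { eapply Rle_trans; [apply (Rabs_pos (F 0 - F 0)) | apply (alexiewicz_norm_spec f F H)];
      generalize PI_RGT_0; lra. }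
  replace (4 * sqrt 2 * Rabs (IZR n) * alexiewicz_norm f)
    with (Rabs (IZR n) * (4 * sqrt 2 * alexiewicz_norm f)) by ring.
  apply Rmult_le_compat_l; [apply Rabs_pos|]. apply Rmult_le_compat_r; [exact N0|].
  generalize PI_4 (sqrt_lt_R0 2 ltac:(lra)). nra.
Qed.

(** * Algebra of Fourier coefficients *)

Lemma is_primitive_cont (f : functional) (F : R -> R) : is_primitive f F -> cont F.
Proof. intros [[C _] _]. exact C. Qed.

Lemma fourier_plus (f g : functional) (F G : R -> R) (n : Z) :
  is_primitive f F -> is_primitive g G ->
  fourier (dist_plus f g) n = Cplus (fourier f n) (fourier g n).
Proof.
  intros HF HG. rewrite (fourier_coef f F), (fourier_coef g G) by assumption.
  rewrite (fourier_coef _ _ n (is_primitive_plus f g F G HF HG)).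
  rewrite !coef_plus by eauto using is_primitive_cont. reflexivity.
Qed.

Lemma fourier_scal (c : R) (f : functional) (F : R -> R) (n : Z) : is_primitive f F ->
  fourier (fun phi => c * f phi) n = Cmult (RtoC c) (fourier f n).
Proof.
  intros HF. rewrite (fourier_coef f F) by assumption.
  rewrite (fourier_coef _ _ n (is_primitive_scal c f F HF)).
  rewrite !coef_scal by eauto using is_primitive_cont.
  unfold Cmult, RtoC. cbn [fst snd]. f_equal; ring.
Qed.

(** Equal distributions have the same primitives, hence the same chosen one. *)
Lemma primitive_ext (f g : functional) : dist_eq f g -> Defs.primitive f = Defs.primitive g.
Proof.
  intro E. unfold Defs.primitive. f_equal. apply functional_extensionality; intro F.
  apply propositional_extensionality. split; apply is_primitive_ext; [exact E|].
  intros phi T. symmetry. now apply E.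
Qed.

Lemma fourier_ext (f g : functional) (n : Z) : dist_eq f g -> fourier f n = fourier g n.
Proof.
  intro E. unfold fourier, cp_int_Cmult, cp_int_mult. now rewrite (primitive_ext f g E).
Qed.

Lemma Cfourier_Cscal (alpha : C) (f : functional) (F : R -> R) (n : Z) : is_primitive f F ->
  Cfourier (dist_Cscal alpha f) n = Cmult alpha (fourier f n).
Proof.
  intro HF. unfold Cfourier.
  rewrite (fourier_ext (fun phi => Re (dist_Cscal alpha f phi)) (fun phi => Re alpha * f phi)).
  2: { intros phi _. unfold dist_Cscal, Cmult, RtoC, Re. cbn [fst snd]. ring. }
  rewrite (fourier_ext (fun phi => Im (dist_Cscal alpha f phi)) (fun phi => Im alpha * f phi)).
  2: { intros phi _. unfold dist_Cscal, Cmult, RtoC, Im. cbn [fst snd]. ring. }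
  rewrite !(fourier_scal _ f F) by exact HF.
  destruct alpha as [a b], (fourier f n) as [u v].
  unfold Cmult, Cplus, RtoC, Ci, Re, Im. cbn [fst snd]. f_equal; ring.
Qed.

Lemma fourier_conj (f : functional) (F : R -> R) (n : Z) : is_primitive f F ->
  Cconj (fourier f n) = fourier f (- n).
Proof.
  intro H. assert (C := is_primitive_cont f F H).
  rewrite !(fourier_coef f F) by exact H. unfold Cconj. cbn [fst snd].
  rewrite !coef_neg, Ropp_0 by exact C. f_equal.
  generalize (coef_rotate F n 0 (- (PI / 2)) C). rewrite !Rplus_0_l.
  rewrite cos_neg, sin_neg, cos_PI2, sin_PI2. lra.
Qed.

Lemma fourier_translate (s : R) (f : functional) (F : R -> R) (n : Z) : is_primitive f F ->
  fourier (dist_translate s f) n = Cmult (fourier f n) (expi (- (IZR n * s))).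
Proof.
  intro H. assert (C := is_primitive_cont f F H).
  rewrite (fourier_coef f F) by exact H.
  rewrite (fourier_coef _ _ n (is_primitive_translate s f F H)).
  rewrite !coef_translate by exact (proj1 H).
  rewrite (Rplus_comm (PI / 2)).
  assert (R1 := coef_rotate F n 0 (IZR n * s) C).
  assert (R2 := coef_rotate F n 0 (IZR n * s + PI / 2) C).
  rewrite !Rplus_0_l in R1, R2. rewrite !Rplus_0_l.
  rewrite R1, R2. unfold expi, Cmult. cbn [fst snd].
  rewrite cos_plus, sin_plus, cos_PI2, sin_PI2, cos_neg, sin_neg. f_equal; ring.
Qed.

(** * Estimates of Fourier coefficients *)

Lemma Cmod_fourier_le_integral (f : functional) (F : R -> R) (n : Z) : is_primitive f F ->
  Cmod (fourier f n) <= Rabs (F PI) + Rabs (IZR n) * RInt (fun x => Rabs (F x)) (- PI) PI.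
Proof.
  intro H. assert (C := is_primitive_cont f F H). assert (HP := PI_RGT_0).
  destruct (Cmod_fourier_coef f F n H) as [phi ->]. unfold coef.
  eapply Rle_trans; [apply Rle_abs|]. eapply Rle_trans; [apply Rabs_triang|].
  rewrite !Rabs_mult. apply Rplus_le_compat.
  - rewrite <- (Rmult_1_r (Rabs (F PI))) at 2. apply Rmult_le_compat_l; [apply Rabs_pos|].
    apply Rabs_le, COS_bound.
  - apply Rmult_le_compat_l; [apply Rabs_pos|].
    eapply Rle_trans; [apply abs_RInt_le; [lra | auto with cont]|].
    apply RInt_le; auto 6 with cont; [lra|]. intros t _. rewrite Rabs_mult.
    rewrite <- (Rmult_1_r (Rabs (F t))) at 2. apply Rmult_le_compat_l; [apply Rabs_pos|].
    apply Rabs_le, SIN_bound.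
Qed.

(** Translation by [PI / n] multiplies the [n]-th coefficient by [-1], so the difference
    [f - tau_{PI/n} f] has twice the coefficient of [f]. *)
Lemma fourier_le_half_period (f : functional) (F : R -> R) (n : Z) : is_primitive f F ->
  n <> 0%Z -> Cmod (fourier f n)
    <= 2 * sqrt 2 * Rabs (IZR n) * alexiewicz_norm (dist_minus f (dist_translate (PI / IZR n) f)).
Proof.
  intros H Hn. set (s := PI / IZR n). set (g := dist_minus f (dist_translate s f)).
  assert (HN : IZR n <> 0) by now apply not_0_IZR.
  assert (Hs := is_primitive_translate s f F H).
  assert (Hg := is_primitive_minus f (dist_translate s f) F _ H Hs). fold g in Hg.
  assert (E : fourier g n = Cmult (RtoC 2) (fourier f n)).
  { rewrite (fourier_ext g (dist_plus f (fun phi => (-1) * dist_translate s f phi)))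
      by (intros phi _; unfold g, dist_plus, dist_minus; ring).
    rewrite (fourier_plus _ _ F _ n H (is_primitive_scal (-1) _ _ Hs)).
    rewrite (fourier_scal _ _ _ n Hs), (fourier_translate s f F n H).
    replace (IZR n * s) with PI by (unfold s; field; exact HN).
    unfold expi. rewrite cos_neg, sin_neg, cos_PI, sin_PI.
    destruct (fourier f n) as [u v]. unfold Cmult, Cplus, RtoC. cbn [fst snd]. f_equal; ring. }
  assert (B := fourier_le_norm g _ n Hg Hn).
  rewrite E, Cmod_mult, Cmod_R, (Rabs_pos_eq 2) in B by lra. lra.
Qed.

(** By [fourier_le_half_period] it suffices that the norm of [f - tau_{PI/n} f] tends
    to 0, and this norm is at most twice the modulus of continuity of [F] at [PI / n]. *)
Lemma fourier_little_o (f : functional) (F : R -> R) : is_primitive f F ->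
  little_o_Z (fourier f) IZR.
Proof.
  intros H eps. assert (HP := PI_RGT_0).
  (* The norm is at most [2 * eps / 12], and [2 * sqrt 2 * (eps / 6) <= eps]. *)
  assert (He : 0 < eps / 12) by (generalize (cond_pos eps); lra).
  destruct (Bc_uniformly_continuous F (eps / 12) (proj1 H) He) as [d [Hd U]].
  exists (up (PI / d)). intros n Hn.
  assert (Hpd : 0 < PI / d) by now apply Rdiv_lt_0_compat.
  assert (HN : PI / d < Rabs (IZR n)).
  { rewrite <- abs_IZR. apply Rlt_le_trans with (IZR (up (PI / d))).
    - apply archimed.
    - now apply IZR_le. }
  assert (Hn0 : n <> 0%Z) by (intros ->; rewrite Rabs_R0 in HN; lra).
  assert (HN0 : IZR n <> 0) by now apply not_0_IZR.
  change (norm (Cmod (fourier f n))) with (Rabs (Cmod (fourier f n))).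
  change (norm (IZR n)) with (Rabs (IZR n)).
  rewrite Rabs_pos_eq by apply Cmod_ge_0.
  eapply Rle_trans; [apply (fourier_le_half_period f F n H Hn0)|].
  set (s := PI / IZR n).
  assert (Ls : Rabs s < d).
  { unfold s, Rdiv. rewrite Rabs_mult, Rabs_inv, (Rabs_pos_eq PI) by lra.
    apply (Rmult_lt_reg_r (Rabs (IZR n))); [lra|].
    rewrite Rmult_assoc, Rinv_l, Rmult_1_r by lra.
    apply (Rmult_lt_compat_l d) in HN; [|exact Hd].
    replace (d * (PI / d)) with PI in HN by (field; lra). exact HN. }
  assert (B : alexiewicz_norm (dist_minus f (dist_translate s f)) <= eps / 6).
  { apply (alexiewicz_norm_spec _ _
      (is_primitive_minus _ _ _ _ H (is_primitive_translate s f F H))).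
    intros a b _ _.
    replace (F b - (F (b - s) - F (- PI - s)) - (F a - (F (a - s) - F (- PI - s))))
      with ((F b - F (b - s)) - (F a - F (a - s))) by ring.
    unfold Rminus at 1. eapply Rle_trans; [apply Rabs_triang|]. rewrite Rabs_Ropp.
    assert (W : forall x, Rabs (F x - F (x - s)) < eps / 12).
    { intro x. apply U. replace (x - (x - s)) with s by ring. exact Ls. }
    generalize (W a) (W b). lra. }
  assert (S2 : sqrt 2 < 2).
  { rewrite <- (sqrt_square 2) at 2 by lra. apply sqrt_lt_1; lra. }
  assert (S0 : 0 < sqrt 2) by (apply sqrt_lt_R0; lra).
  replace (2 * sqrt 2 * Rabs (IZR n) * alexiewicz_norm (dist_minus f (dist_translate s f)))
    with (2 * (sqrt 2 * alexiewicz_norm (dist_minus f (dist_translate s f))) * Rabs (IZR n)) by ring.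
  apply Rmult_le_compat_r; [apply Rabs_pos|].
  apply Rle_trans with (2 * (sqrt 2 * (eps / 6))).
  - apply Rmult_le_compat_l; [lra|]. apply Rmult_le_compat_l; lra.
  - generalize (cond_pos eps). nra.
Qed.

(** * Derivatives of periodic functions *)

(** Integration by parts; the boundary terms vanish outside the support of the test
    function. *)
Lemma dist_deriv_C1 (G dG : R -> R) : (forall x, is_derive G x (dG x)) -> cont dG ->
  dist_eq (dist_deriv (dist_of_fun G)) (dist_of_fun dG).
Proof.
  intros D C phi T. destruct (test_function_support _ T) as [M [M0 V]].
  assert (V1 : vanishes_outside (M + 1) phi) by (apply vanishes_outside_weaken with (2 := V); lra).
  assert (CG := cont_derivable _ _ D).
  assert (T' := test_function_cont _ (test_function_Derive _ T)).
  assert (T0 := test_function_cont _ T).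
  rewrite (dist_deriv_of_fun G phi (M + 1)), (dist_of_fun_RInt dG phi (M + 1)); auto; try lra.
  rewrite (RInt_parts G dG phi (Derive phi)); auto.
  2: { intro; now apply test_function_is_derive. }
  rewrite !V; [ring | |]; [rewrite Rabs_left | rewrite Rabs_pos_eq]; lra.
Qed.

Lemma dist_deriv_const (c : R) (F : R -> R) : cont F ->
  dist_eq (dist_deriv (dist_of_fun F)) (dist_deriv (dist_of_fun (fun x => F x - c))).
Proof.
  intros C phi T. destruct (test_function_support _ T) as [M [M0 V]].
  assert (V1 : vanishes_outside (M + 1) phi) by (apply vanishes_outside_weaken with (2 := V); lra).
  assert (T' := test_function_cont _ (test_function_Derive _ T)).
  rewrite !(dist_deriv_of_fun _ phi (M + 1)); auto with cont; try lra.
  f_equal. rewrite (RInt_ext (fun x => (F x - c) * _)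
    (fun x => F x * Derive phi x - c * Derive phi x)) by (intros; Rring).
  rewrite RInt_minus_cont, RInt_scal_cont, (RInt_Derive_test phi M) by auto with cont. Rring.
Qed.

Lemma is_primitive_dist_deriv (F : R -> R) : CkT 0 F ->
  is_primitive (dist_deriv (dist_of_fun F)) (fun x => F x - F (- PI)).
Proof.
  intros [P H]. assert (C : cont F) by (intro x; apply (H O x (le_n _))).
  split; [|now apply dist_deriv_const].
  apply Bc_intro; auto with cont; [ring|]. intro y. rewrite P.
  replace (F PI) with (F (- PI)); [ring|]. rewrite <- P. f_equal. ring.
Qed.

Lemma is_primitive_dist_of_fun (F : R -> R) : CkT 0 F ->
  is_primitive (dist_of_fun F) (fun x => RInt F (- PI) x).
Proof.
  intros [P H]. assert (C : cont F) by (intro x; apply (H O x (le_n _))).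
  assert (D : forall x, is_derive (fun x => RInt F (- PI) x) x (F x))
    by (intro; now apply is_derive_RInt_cont).
  split.
  - apply Bc_intro.
    + exact (cont_derivable _ _ D).
    + apply (RInt_point (- PI) F).
    + intro y. rewrite <- (RInt_Chasles_cont F (- PI) PI (y + 2 * PI)) by exact C.
      rewrite Rplus_comm. f_equal.
      replace PI with (- PI + 2 * PI) at 1 by ring.
      rewrite <- (RInt_shift F) by exact C. apply RInt_ext. intros; apply P.
  - intros phi T. symmetry. now apply dist_deriv_C1.
Qed.

(** The primitive of [F'] is [F] up to a constant, and that of [F] is its integral;
    integrating by parts in [coef] for the latter leaves [int F(t) cos(n t + th) dt], a quarter
    period away from [int F(t) sin(n t + th) dt] in the former. *)
Lemma fourier_dist_deriv (F : R -> R) (n : Z) : CkT 0 F ->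
  fourier (dist_deriv (dist_of_fun F)) n
  = Cmult (Cmult Ci (RtoC (IZR n))) (fourier (dist_of_fun F) n).
Proof.
  intro H. assert (C : cont F) by (intro x; apply (proj2 H O x (le_n _))).
  assert (EP : F PI = F (- PI)).
  { rewrite <- (proj1 H (- PI)). f_equal. ring. }
  rewrite (fourier_coef _ _ n (is_primitive_dist_deriv F H)).
  rewrite (fourier_coef _ _ n (is_primitive_dist_of_fun F H)).
  assert (A : forall th, coef (fun x => F x - F (- PI)) n th
     = IZR n * RInt (fun t => F t * sin (IZR n * t + th)) (- PI) PI).
  { intro th. unfold coef. rewrite EP, Rminus_diag, Rmult_0_l, Rplus_0_l.
    rewrite (RInt_ext _ (fun t => F t * sin (IZR n * t + th) - F (- PI) * sin (IZR n * t + th)))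
      by (intros; Rring).
    rewrite RInt_minus_cont, RInt_scal_cont by auto with cont.
    generalize (RInt_sin_wave n th (- PI)). replace (- PI + 2 * PI) with PI by ring.
    set (S := RInt (fun t => sin (IZR n * t + th)) (- PI) PI : R). intro ES.
    rewrite Rmult_minus_distr_l.
    replace (IZR n * (F (- PI) * S)) with (F (- PI) * (IZR n * S)) by ring.
    rewrite ES. ring. }
  assert (B : forall th, coef (fun x => RInt F (- PI) x) n th
     = RInt (fun t => F t * cos (IZR n * t + th)) (- PI) PI).
  { intro th. unfold coef.
    rewrite (RInt_parts (fun x => RInt F (- PI) x) F (fun t => cos (IZR n * t + th))
      (fun t => - IZR n * sin (IZR n * t + th))).
    - rewrite (RInt_ext (fun t => RInt F (- PI) t * (- IZR n * _))
        (fun t => - IZR n * (RInt F (- PI) t * sin (IZR n * t + th)))) by (intros; Rring).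
      rewrite RInt_scal_cont.
      + replace (RInt F (- PI) (- PI)) with 0 by (symmetry; apply (RInt_point (- PI) F)). ring.
      + apply cont_mult; auto with cont.
        apply cont_derivable with F. intro; now apply is_derive_RInt_cont.
    - intro; now apply is_derive_RInt_cont.
    - intro; apply is_derive_cos_wave.
    - exact C.
    - auto with cont. }
  rewrite !A, !B. rewrite !(RInt_ext (fun t => F t * sin (IZR n * t + 0))
    (fun t => (-1) * (F t * cos (IZR n * t + PI / 2)))).
  2: { intros t _. rewrite (Rplus_comm _ (PI / 2)), Rplus_0_r, sin_cos. Rring. }
  rewrite (RInt_ext (fun t => F t * sin (IZR n * t + PI / 2)) (fun t => F t * cos (IZR n * t + 0))).
  2: { intros t _. rewrite (Rplus_comm _ (PI / 2)), Rplus_0_r, cos_sin. Rring. }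
  rewrite RInt_scal_cont by auto with cont.
  unfold Cmult, Ci, RtoC. cbn [fst snd]. f_equal; ring.
Qed.

Lemma dist_deriv_ext (f g : functional) : dist_eq f g -> dist_eq (dist_deriv f) (dist_deriv g).
Proof.
  intros E phi T. unfold dist_deriv. f_equal. now apply E, test_function_Derive.
Qed.

Lemma CkT_S (k : nat) (F : R -> R) : CkT (S k) F -> CkT k (Derive F).
Proof.
  intros [P H]. split.
  - intro x. symmetry.
    assert (D : is_derive F (x + 2 * PI) (Derive F (x + 2 * PI))).
    { apply Derive_correct. apply (H 1%nat); lia. }
    apply is_derive_unique.
    apply is_derive_ext with (fun x => F (x + 2 * PI)); [exact P|].
    auto_derive; [exact (ex_intro _ _ D)|]. change (Derive (fun x => F x)) with (Derive F). ring.
  - intros j x Hj. destruct (H (S j) x ltac:(lia)) as [H1 H2].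
    rewrite Derive_n_S_inner in H2. split; [|exact H2].
    destruct j as [|j]; [exact I|].
    change (ex_derive (Derive_n (Derive F) j) x). rewrite <- Derive_n_S_inner. exact H1.
Qed.

Lemma CkT_weaken (k : nat) (F : R -> R) : CkT (S k) F -> CkT k F.
Proof. intros [P H]. split; [exact P|]. intros j x Hj. apply H. lia. Qed.

Lemma CkT_0 (k : nat) (F : R -> R) : CkT k F -> CkT 0 F.
Proof. induction k; auto using CkT_weaken. Qed.

Lemma dist_deriv_n_S (T : functional) (l : nat) :
  dist_deriv_n T (S l) = dist_deriv_n (dist_deriv T) l.
Proof. unfold dist_deriv_n. apply Nat.iter_succ_r. Qed.

Lemma dist_deriv_n_ext (f g : functional) (l : nat) :
  dist_eq f g -> dist_eq (dist_deriv_n f l) (dist_deriv_n g l).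
Proof.
  intro E. induction l as [|l IH]; [exact E|]. now apply dist_deriv_ext.
Qed.

Lemma dist_deriv_CkT (k : nat) (F : R -> R) : CkT (S k) F ->
  dist_eq (dist_deriv (dist_of_fun F)) (dist_of_fun (Derive F)).
Proof.
  intro H. apply dist_deriv_C1.
  - intro x. apply Derive_correct. apply (proj2 H 1%nat); lia.
  - intro x. apply (proj2 (CkT_S k F H) 0%nat); lia.
Qed.

Lemma has_primitive_dist_deriv_n (k l : nat) (F : R -> R) : CkT k F -> (l <= S k)%nat ->
  exists G, is_primitive (dist_deriv_n (dist_of_fun F) l) G.
Proof.
  revert F l. induction k as [|k IH]; intros F [|l] H Hl.
  - eexists. now apply is_primitive_dist_of_fun.
  - replace l with O by lia. eexists. now apply is_primitive_dist_deriv.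
  - eexists. apply is_primitive_dist_of_fun. now apply CkT_0 in H.
  - destruct (IH (Derive F) l (CkT_S k F H) ltac:(lia)) as [G HG]. exists G.
    apply is_primitive_ext with (2 := HG). rewrite dist_deriv_n_S.
    intros phi T. symmetry.
    exact (dist_deriv_n_ext _ _ l (dist_deriv_CkT k F H) phi T).
Qed.

(** While [F] is C^1, differentiating the distribution differentiates the function; the last
    derivative, of order [S k], is that of a merely continuous function. *)
Lemma fourier_dist_deriv_n (k l : nat) (F : R -> R) (n : Z) : CkT k F -> (l <= S k)%nat ->
  fourier (dist_deriv_n (dist_of_fun F) l) n
  = Cmult (Cpow (Cmult Ci (RtoC (IZR n))) l) (fourier (dist_of_fun F) n).
Proof.
  revert F l. induction k as [|k IH]; intros F [|l] H Hl.
  - cbn. now rewrite Cmult_1_l.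
  - replace l with O by lia. rewrite Cpow_1_r. now apply fourier_dist_deriv.
  - cbn. now rewrite Cmult_1_l.
  - rewrite dist_deriv_n_S.
    rewrite (fourier_ext _ _ n (dist_deriv_n_ext _ _ l (dist_deriv_CkT k F H))).
    rewrite IH by (apply CkT_S, H || lia).
    rewrite <- (fourier_ext _ _ n (dist_deriv_CkT k F H)), fourier_dist_deriv, Cpow_S
      by (now apply CkT_0 in H).
    ring.
Qed.

Lemma Ci_IZR_neq_0 (n : Z) : n <> 0%Z -> Cmult Ci (RtoC (IZR n)) <> 0.
Proof.
  intro Hn. apply Cmod_gt_0. rewrite Cmod_mult, Cmod_Ci, Cmod_R, Rmult_1_l.
  apply Rabs_pos_lt. now apply not_0_IZR.
Qed.

Lemma fourier_of_derivative (k l : nat) (F : R -> R) (n : Z) : CkT k F -> (l <= S k)%nat ->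
  n <> 0%Z ->
  fourier (dist_of_fun F) n
  = Cmult (Cinv (Cpow (Cmult Ci (RtoC (IZR n))) l)) (fourier (dist_deriv_n (dist_of_fun F) l) n).
Proof.
  intros H Hl Hn. rewrite (fourier_dist_deriv_n k l F n H Hl).
  rewrite Cmult_assoc, Cinv_l, Cmult_1_l; [reflexivity|].
  now apply Cpow_nz, Ci_IZR_neq_0.
Qed.

Lemma Cmod_fourier_of_derivative (k l : nat) (F : R -> R) (n : Z) : CkT k F ->
  (l <= S k)%nat -> n <> 0%Z ->
  Cmod (fourier (dist_of_fun F) n)
  = Cmod (fourier (dist_deriv_n (dist_of_fun F) l) n) / Rabs (IZR n) ^ l.
Proof.
  intros H Hl Hn. rewrite (fourier_of_derivative k l F n H Hl Hn) at 1.
  rewrite Cmod_mult, Cmod_inv by now apply Cpow_nz, Ci_IZR_neq_0.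
  rewrite Cmod_pow, Cmod_mult, Cmod_Ci, Cmod_R, Rmult_1_l. apply Rmult_comm.
Qed.

Lemma min_upto_glb (u : nat -> R) (k : nat) (c : R) :
  (forall l, (l <= k)%nat -> c <= u l) -> c <= min_upto u k.
Proof.
  induction k as [|k IH]; intro H; [apply H; lia|].
  apply Rmin_glb; [apply IH; intros; apply H; lia | apply H; lia].
Qed.

Lemma fourier_le_min_norm (k : nat) (F : R -> R) (n : Z) : CkT k F -> n <> 0%Z ->
  Cmod (fourier (dist_of_fun F) n)
  <= 4 * sqrt 2
     * min_upto (fun l => alexiewicz_norm (dist_deriv_n (dist_of_fun F) l)
                          / powerRZ (Rabs (IZR n)) (Z.of_nat l - 1)) (S k).
Proof.
  intros H Hn. assert (S0 : 0 < sqrt 2) by (apply sqrt_lt_R0; lra).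
  assert (N0 : 0 < Rabs (IZR n)) by now apply Rabs_pos_lt, not_0_IZR.
  rewrite Rmult_comm. apply Rle_div_l; [lra|]. apply min_upto_glb. intros l Hl.
  apply Rle_div_l; [lra|].
  rewrite (Cmod_fourier_of_derivative k l F n H Hl Hn).
  assert (N1 : 0 < Rabs (IZR n) ^ l) by now apply pow_lt.
  apply Rle_div_l; [exact N1|].
  destruct (has_primitive_dist_deriv_n k l F H Hl) as [G HG].
  eapply Rle_trans; [apply (fourier_le_norm _ G n HG Hn)|].
  unfold Zminus. rewrite powerRZ_add by lra. rewrite <- pow_powerRZ. cbn [powerRZ Pos.to_nat].
  apply Req_le. simpl. field. lra.
Qed.

Lemma fourier_smooth_little_o (k : nat) (F : R -> R) : CkT k F ->
  little_o_Z (fourier (dist_of_fun F)) (fun n => powerRZ (IZR n) (1 - Z.of_nat (S k))).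
Proof.
  intros H eps. destruct (has_primitive_dist_deriv_n k (S k) F H (le_n _)) as [G HG].
  destruct (fourier_little_o _ G HG eps) as [N HN]. exists (Z.max N 1). intros n Hn.
  assert (Hn0 : n <> 0%Z) by lia.
  assert (HN0 : IZR n <> 0) by now apply not_0_IZR.
  specialize (HN n ltac:(lia)).
  change (Rabs (Cmod (fourier (dist_deriv_n (dist_of_fun F) (S k)) n)) <= eps * Rabs (IZR n)) in HN.
  change (Rabs (Cmod (fourier (dist_of_fun F) n))
     <= eps * Rabs (powerRZ (IZR n) (1 - Z.of_nat (S k)))).
  rewrite Rabs_pos_eq in * by apply Cmod_ge_0.
  rewrite (Cmod_fourier_of_derivative k (S k) F n H (le_n _) Hn0).
  unfold Zminus. rewrite powerRZ_add by exact HN0.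
  rewrite powerRZ_neg', <- pow_powerRZ, powerRZ_1, Rabs_mult, Rabs_inv, <- RPow_abs.
  unfold Rdiv. rewrite <- Rmult_assoc. apply Rmult_le_compat_r; [|exact HN].
  apply Rlt_le, Rinv_0_lt_compat, pow_lt. now apply Rabs_pos_lt.
Qed.

(** * Sharpness *)

(** For sequential continuity, the pairing is at most the supremum of the first derivative
    times the integral of [|F|] over the common support. *)
Lemma is_distribution_dist_deriv (F : R -> R) : cont F ->
  is_distribution (dist_deriv (dist_of_fun F)).
Proof.
  intro C. split.
  - intros phi psi a b Tp Tq.
    destruct (test_function_support _ Tp) as [M [M0 VM]].
    destruct (test_function_support _ Tq) as [N [N0 VN]].
    assert (VM' : vanishes_outside (M + N) phi) by (apply vanishes_outside_weaken with (2 := VM); lra).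
    assert (VN' : vanishes_outside (M + N) psi) by (apply vanishes_outside_weaken with (2 := VN); lra).
    assert (Cp := test_function_cont _ (test_function_Derive _ Tp)).
    assert (Cq := test_function_cont _ (test_function_Derive _ Tq)).
    rewrite !(dist_deriv_of_fun F _ (M + N)); auto using test_function_lin; try lra.
    2: { intros x Hx. rewrite VM', VN' by exact Hx. ring. }
    rewrite (RInt_ext _ (fun x => a * (F x * Derive phi x) + b * (F x * Derive psi x))).
    + rewrite RInt_plus_cont, !RInt_scal_cont by auto with cont. ring.
    + intros x _.
      rewrite (is_derive_unique _ x (a * Derive phi x + b * Derive psi x)); [Rring|].
      apply (is_derive_plus (fun x => a * phi x) (fun x => b * psi x));
        apply is_derive_scal; now apply test_function_is_derive.
  - intros phi T [[M0 V0] E]. set (M := Rmax M0 0).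
    assert (M1 : 0 <= M) by apply Rmax_r.
    assert (V : forall m, vanishes_outside M (phi m))
      by (intro m; apply vanishes_outside_weaken with (2 := V0 m), Rmax_l).
    set (B := RInt (fun x => Rabs (F x)) (- M) M : R).
    assert (B0 : 0 <= B).
    { apply RInt_ge_0; [lra | auto with cont | intros; apply Rabs_pos]. }
    apply is_lim_seq_spec. intro eps.
    assert (He : 0 < eps / (B + 1)) by (apply Rdiv_lt_0_compat; [apply cond_pos | lra]).
    generalize (E 1%nat (mkposreal _ He)). apply filter_imp. intros m Hm.
    assert (Cm := test_function_cont _ (test_function_Derive _ (T m))).
    rewrite Rminus_0_r, (dist_deriv_of_fun F (phi m) M), Rabs_Ropp; auto.
    apply Rle_lt_trans with (eps / (B + 1) * B).
    + eapply Rle_trans; [apply abs_RInt_le; [lra | auto with cont]|].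
      unfold B. rewrite <- RInt_scal_cont by auto with cont.
      apply RInt_le; auto 6 with cont; [lra|]. intros x _.
      rewrite Rabs_mult, Rmult_comm. apply Rmult_le_compat_r; [apply Rabs_pos|].
      apply Rlt_le, (Hm x).
    + assert (P := cond_pos eps). apply Rmult_lt_reg_r with (B + 1); [lra|].
      replace (eps / (B + 1) * B * (B + 1)) with (eps * B) by (field; lra). lra.
Qed.

Lemma RInt_sin_sin (p q : Z) : (0 < p)%Z -> (0 < q)%Z ->
  RInt (fun t => sin (IZR p * t + 0) * sin (IZR q * t + 0)) (- PI) PI
  = if Z.eq_dec p q then PI else 0.
Proof.
  intros Hp Hq. apply IZR_lt in Hp, Hq.
  assert (S : forall (m : Z) c, sin (IZR m * PI) / c - sin (IZR m * - PI) / c = 0).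
  { intros m c. rewrite <- (sin_shift_Z (IZR m * - PI) m).
    replace (IZR m * - PI + 2 * IZR m * PI) with (IZR m * PI) by ring. ring. }
  destruct (Z.eq_dec p q) as [<-|Hpq].
  - rewrite (RInt_of_derivative (fun t => t / 2 - sin (IZR (2 * p) * t) / (4 * IZR p))).
    + generalize (S (2 * p)%Z (4 * IZR p)). lra.
    + intro t. rewrite mult_IZR. auto_derive; [exact I|].
      rewrite Rplus_0_r. replace (2 * IZR p * t) with (2 * (IZR p * t)) by ring.
      rewrite cos_2a_sin. field. lra.
    + auto with cont.
  - assert (Hd : IZR p - IZR q <> 0) by (intro E; apply Hpq, eq_IZR; lra).
    rewrite (RInt_of_derivative (fun t => sin (IZR (p - q) * t) / (2 * (IZR p - IZR q))
       - sin (IZR (p + q) * t) / (2 * (IZR p + IZR q)))).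
    + generalize (S (p - q)%Z (2 * (IZR p - IZR q))) (S (p + q)%Z (2 * (IZR p + IZR q))). lra.
    + intro t. rewrite plus_IZR, minus_IZR. auto_derive; [exact I|].
      rewrite !Rplus_0_r.
      replace ((IZR p - IZR q) * t) with (IZR p * t - IZR q * t) by ring.
      replace ((IZR p + IZR q) * t) with (IZR p * t + IZR q * t) by ring.
      rewrite cos_minus, cos_plus. field. lra.
    + auto with cont.
Qed.

(** The summand [+ 0] writes the sine as the wave of phase 0 that occurs in [coef]. *)
Definition lacunary_term (n : nat -> nat) (k : nat) (x : R) : R :=
  (1 / 2) ^ k * sin (IZR (Z.of_nat (n k)) * x + 0).

Definition lacunary (n : nat -> nat) (x : R) : R := Series (fun k => lacunary_term n k x).

Lemma lacunary_term_bound (n : nat -> nat) (k : nat) (x : R) :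
  Rabs (lacunary_term n k x) <= (1 / 2) ^ k.
Proof.
  unfold lacunary_term. assert (0 < (1 / 2) ^ k) by (apply pow_lt; lra).
  rewrite Rabs_mult, (Rabs_pos_eq ((1 / 2) ^ k)) by lra.
  rewrite <- (Rmult_1_r ((1 / 2) ^ k)) at 2. apply Rmult_le_compat_l; [lra|].
  apply Rabs_le, SIN_bound.
Qed.

Lemma ex_series_lacunary (n : nat -> nat) (x : R) : ex_series (fun k => lacunary_term n k x).
Proof.
  apply (ex_series_le (V := R_CompleteNormedModule)) with (fun k => (1 / 2) ^ k).
  - intro k. apply lacunary_term_bound.
  - apply ex_series_geom. rewrite Rabs_pos_eq; lra.
Qed.

(** The tail is dominated by a geometric series, uniformly in [x]. *)
Lemma lacunary_tail (n : nat -> nat) (K : nat) (x : R) :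
  Rabs (lacunary n x - sum_n (fun k => lacunary_term n k x) K) <= (1 / 2) ^ K.
Proof.
  unfold lacunary. rewrite (Series_incr_n _ (S K)); [| lia | apply ex_series_lacunary].
  rewrite <- sum_n_Reals. cbn [pred].
  rewrite Rplus_comm. unfold Rminus. rewrite Rplus_assoc, Rplus_opp_r, Rplus_0_r.
  assert (G : is_series (fun k => (1 / 2) ^ S K * (1 / 2) ^ k) ((1 / 2) ^ S K * / (1 - 1 / 2))).
  { apply (is_series_scal_l (K := R_AbsRing) ((1 / 2) ^ S K) (fun k => (1 / 2) ^ k)).
    apply is_series_geom. rewrite Rabs_pos_eq; lra. }
  replace ((1 / 2) ^ K) with (Series (fun k => (1 / 2) ^ S K * (1 / 2) ^ k)).
  2: { rewrite (is_series_unique _ _ G). simpl. field. }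
  assert (B : forall k, 0 <= Rabs (lacunary_term n (S K + k) x) <= (1 / 2) ^ S K * (1 / 2) ^ k).
  { intro k. split; [apply Rabs_pos|]. rewrite <- pow_add. apply lacunary_term_bound. }
  eapply Rle_trans; [apply Series_Rabs|].
  - apply (ex_series_le (V := R_CompleteNormedModule)) with (fun k => (1 / 2) ^ S K * (1 / 2) ^ k).
    + intro k. change (Rabs (Rabs (lacunary_term n (S K + k) x)) <= (1 / 2) ^ S K * (1 / 2) ^ k).
      rewrite Rabs_Rabsolu. apply B.
    + eexists; exact G.
  - apply Series_le; [exact B | eexists; exact G].
Qed.

Lemma pow_half_small (eps : R) : 0 < eps -> exists K0, forall K, (K0 <= K)%nat -> (1 / 2) ^ K < eps.
Proof.
  intro He. destruct (pow_lt_1_zero (1 / 2) ltac:(rewrite Rabs_pos_eq; lra) eps He) as [K0 H].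
  exists K0. intros K HK. specialize (H K HK). rewrite Rabs_pos_eq in H; [exact H|].
  apply pow_le. lra.
Qed.

Lemma cont_lacunary_sum (n : nat -> nat) (K : nat) :
  cont (fun x => sum_n (fun k => lacunary_term n k x) K).
Proof.
  assert (T : forall k, cont (lacunary_term n k)) by (intro; unfold lacunary_term; auto with cont).
  induction K as [|K IH].
  - replace (fun x => sum_n _ 0) with (lacunary_term n 0); [apply T|].
    apply functional_extensionality; intro x. now rewrite sum_O.
  - replace (fun x => sum_n _ (S K))
      with (fun x => sum_n (fun k => lacunary_term n k x) K + lacunary_term n (S K) x);
      [auto with cont|].
    apply functional_extensionality; intro x. now rewrite sum_Sn.
Qed.

Lemma cont_lacunary (n : nat -> nat) : cont (lacunary n).
Proof.
  intro x. apply filterlim_locally. intro eps.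
  assert (He : 0 < eps / 3) by (generalize (cond_pos eps); lra).
  destruct (pow_half_small _ He) as [K HK]. specialize (HK K (le_n _)).
  destruct (continuous_eps _ x _ (cont_lacunary_sum n K x) He) as [d [Hd C]].
  exists (mkposreal _ Hd). intros y Hy. specialize (C y Hy). cbn beta in C.
  change (Rabs (lacunary n y - lacunary n x) < eps).
  assert (Tx := lacunary_tail n K x). assert (Ty := lacunary_tail n K y).
  apply Rabs_def2 in C. apply Rabs_le_between in Tx, Ty. apply Rabs_def1; lra.
Qed.

Lemma lacunary_zero (n : nat -> nat) (m : Z) : lacunary n (IZR m * PI) = 0.
Proof.
  unfold lacunary. rewrite (Series_ext _ (fun k => 0 * 1)); [rewrite Series_scal_l; ring|].
  intro k. unfold lacunary_term. rewrite (sin_eq_0_1 (_ + _)); [ring|].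
  exists (Z.of_nat (n k) * m)%Z. rewrite mult_IZR. ring.
Qed.

Lemma Bc_lacunary (n : nat -> nat) : Bc (lacunary n).
Proof.
  assert (Z : lacunary n (- PI) = 0).
  { rewrite <- (lacunary_zero n (- 1)). f_equal. ring. }
  assert (P : forall y, lacunary n (y + 2 * PI) = lacunary n y).
  { intro y. apply Series_ext. intro k. unfold lacunary_term.
    rewrite <- (sin_shift_Z (IZR (Z.of_nat (n k)) * y + 0) (Z.of_nat (n k))).
    do 2 f_equal. ring. }
  apply Bc_intro; [exact (cont_lacunary n) | exact Z |].
  intro y. rewrite P. replace PI with (- PI + 2 * PI) by ring. rewrite P, Z. ring.
Qed.

(** All the integrals of [sin(n_k t) sin(n_j t)] are nonnegative, so the term of index [j]
    alone bounds the sum from below, even if the frequency [n j] is repeated. *)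
Lemma RInt_lacunary_sum (n : nat -> nat) (n_pos : forall k, (0 < n k)%nat) (j K : nat) :
  (if le_dec j K then (1 / 2) ^ j * PI else 0)
  <= RInt (fun t => sum_n (fun k => lacunary_term n k t) K * sin (IZR (Z.of_nat (n j)) * t + 0))
       (- PI) PI.
Proof.
  assert (HP := PI_RGT_0).
  assert (T : forall k, cont (lacunary_term n k)) by (intro; unfold lacunary_term; auto with cont).
  assert (E : forall k, RInt (fun t => lacunary_term n k t * sin (IZR (Z.of_nat (n j)) * t + 0)) (- PI) PI
     = (1 / 2) ^ k * if Z.eq_dec (Z.of_nat (n k)) (Z.of_nat (n j)) then PI else 0).
  { intro k. rewrite <- RInt_sin_sin; [| generalize (n_pos k); lia | generalize (n_pos j); lia].
    rewrite <- RInt_scal_cont by auto with cont. apply RInt_ext. intros t _.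
    unfold lacunary_term. Rring. }
  assert (P : forall k, 0 < (1 / 2) ^ k) by (intro k; apply pow_lt; lra).
  induction K as [|K IH].
  - rewrite (RInt_ext _ (fun t => lacunary_term n 0 t * sin (IZR (Z.of_nat (n j)) * t + 0)))
      by (intros; now rewrite sum_O).
    rewrite E. destruct (le_dec j 0) as [Hj|Hj].
    + replace j with O by lia. destruct (Z.eq_dec _ _); [lra | contradiction].
    + simpl. destruct (Z.eq_dec _ _); lra.
  - rewrite (RInt_ext _ (fun t =>
      sum_n (fun k => lacunary_term n k t) K * sin (IZR (Z.of_nat (n j)) * t + 0)
      + lacunary_term n (S K) t * sin (IZR (Z.of_nat (n j)) * t + 0))).
    2: { intros t _. rewrite sum_Sn. apply Rmult_plus_distr_r. }
    assert (CK := cont_lacunary_sum n K).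
    rewrite RInt_plus_cont, E by auto with cont. specialize (P (S K)).
    destruct (le_dec j (S K)) as [Hj|Hj], (le_dec j K) as [Hj'|Hj']; try lia.
    + destruct (Z.eq_dec _ _); nra.
    + replace j with (S K) in * by lia. destruct (Z.eq_dec _ _); [lra | contradiction].
    + destruct (Z.eq_dec _ _); nra.
Qed.

(** The partial sums converge uniformly ([lacunary_tail]), so the lower bound of
    [RInt_lacunary_sum] passes to the limit. *)
Lemma RInt_lacunary (n : nat -> nat) (n_pos : forall k, (0 < n k)%nat) (j : nat) :
  (1 / 2) ^ j * PI
  <= RInt (fun t => lacunary n t * sin (IZR (Z.of_nat (n j)) * t + 0)) (- PI) PI.
Proof.
  assert (HP := PI_RGT_0). assert (CL := cont_lacunary n).
  apply Rnot_lt_le. intro L.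
  set (J := RInt (fun t => lacunary n t * sin (IZR (Z.of_nat (n j)) * t + 0)) (- PI) PI : R) in *.
  assert (He : 0 < ((1 / 2) ^ j * PI - J) / (2 * PI)) by (apply Rdiv_lt_0_compat; lra).
  destruct (pow_half_small _ He) as [K0 H]. set (K := (K0 + j)%nat).
  specialize (H K ltac:(lia)). assert (A := RInt_lacunary_sum n n_pos j K).
  destruct (le_dec j K) as [Hj|Hj]; [|lia].
  assert (CK := cont_lacunary_sum n K).
  set (Q := RInt (fun t => sum_n (fun k => lacunary_term n k t) K * sin (IZR (Z.of_nat (n j)) * t + 0))
       (- PI) PI : R) in *.
  assert (D : Rabs (J - Q) <= (PI - - PI) * (1 / 2) ^ K).
  { unfold J, Q. rewrite <- RInt_minus_cont by auto with cont.
    apply abs_RInt_le_const; [lra | auto with cont |]. intros t _.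
    rewrite <- Rmult_minus_distr_r, Rabs_mult, <- (Rmult_1_r ((1 / 2) ^ K)).
    apply Rmult_le_compat; try apply Rabs_pos; [apply lacunary_tail|].
    apply Rabs_le, SIN_bound. }
  apply Rabs_le_between in D. apply Rlt_div_r in H; lra.
Qed.

(** The frequencies [n k > k] are chosen with [psi (n k) <= 2^(-k) n k], which is possible
    since [psi] is [o(n)]; the coefficient of frequency [n j] then has real part at least
    [n j * 2^(-j) * PI >= PI * psi (n j)]. *)
Lemma little_o_sharp (psi : nat -> R) : (forall m : nat, (1 <= m)%nat -> 0 < psi m) ->
  is_domin eventually INR psi ->
  exists h : functional, Ac h /\ ~ little_o_Z (fourier h) (fun n => psi (Z.abs_nat n)).
Proof.
  intros Hpos Hdom. assert (HP := PI_RGT_0).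
  assert (X : forall k : nat, exists m : nat, (k < m)%nat /\ psi m <= (1 / 2) ^ k * INR m).
  { intro k. assert (He : 0 < (1 / 2) ^ k) by (apply pow_lt; lra).
    destruct (Hdom (mkposreal _ He)) as [N HN]. exists (N + S k)%nat. split; [lia|].
    specialize (HN (N + S k)%nat ltac:(lia)).
    change (Rabs (psi (N + S k)%nat) <= (1 / 2) ^ k * Rabs (INR (N + S k))) in HN.
    rewrite (Rabs_pos_eq (INR _)) in HN by apply pos_INR.
    eapply Rle_trans; [apply Rle_abs | exact HN]. }
  set (n := fun k => proj1_sig (constructive_indefinite_description _ (X k))).
  assert (Hn : forall k, (k < n k)%nat /\ psi (n k) <= (1 / 2) ^ k * INR (n k)).
  { intro k. exact (proj2_sig (constructive_indefinite_description _ (X k))). }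
  assert (n_pos : forall k, (0 < n k)%nat) by (intro k; generalize (proj1 (Hn k)); lia).
  set (F := lacunary n). assert (B : Bc F) by now apply Bc_lacunary.
  set (h := dist_deriv (dist_of_fun F)).
  assert (P : is_primitive h F) by (split; [exact B | intros phi _; reflexivity]).
  exists h. split.
  - split; [|now exists F]. apply is_distribution_dist_deriv. exact (proj1 B).
  - intro O. destruct (O (mkposreal 1 Rlt_0_1)) as [N HN].
    set (j := Z.to_nat N). destruct (Hn j) as [Hj Hpsi].
    specialize (HN (Z.of_nat (n j)) ltac:(lia)).
    rewrite Zabs2Nat.id in HN.
    assert (p0 := Hpos (n j) ltac:(lia)).
    change (Rabs (Cmod (fourier h (Z.of_nat (n j)))) <= 1 * Rabs (psi (n j))) in HN.
    rewrite (Rabs_pos_eq (psi _)), Rabs_pos_eq in HN by (apply Cmod_ge_0 || lra).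
    assert (G := re_le_Cmod (fourier h (Z.of_nat (n j)))).
    rewrite (fourier_coef h F _ P) in G at 1. unfold Re in G. cbn [fst] in G.
    unfold coef in G.
    assert (FP : F PI = 0).
    { rewrite <- (Rmult_1_l PI). exact (lacunary_zero n 1). }
    rewrite FP, Rmult_0_l, Rplus_0_l in G.
    assert (A := RInt_lacunary n n_pos j). fold F in A.
    set (J := RInt (fun t => F t * sin (IZR (Z.of_nat (n j)) * t + 0)) (- PI) PI : R) in *.
    assert (N0 := pos_INR (n j)). rewrite <- INR_IZR_INZ in *.
    assert (W : PI * psi (n j) <= INR (n j) * J).
    { apply Rle_trans with (INR (n j) * ((1 / 2) ^ j * PI)).
      - replace (INR (n j) * ((1 / 2) ^ j * PI)) with (PI * ((1 / 2) ^ j * INR (n j))) by ring.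
        apply Rmult_le_compat_l; lra.
      - now apply Rmult_le_compat_l. }
    assert (Q := PI2_1).
    assert (V : 1 * psi (n j) < PI * psi (n j)) by (apply Rmult_lt_compat_r; lra).
    generalize (Rle_abs (INR (n j) * J)). lra.
Qed.

(** * The theorem *)

Theorem theorem2 (f g : functional) (hf : Ac f) (hg : Ac g) :
  (* (a) *)
  (forall n : Z, fourier (dist_plus f g) n = Cplus (fourier f n) (fourier g n)) /\
  (* (b) *)
  (forall (alpha : C) (n : Z),
     Cfourier (dist_Cscal alpha f) n = Cmult alpha (fourier f n)) /\
  (* (c) *)
  (forall n : Z, Cconj (fourier f n) = fourier f (- n)) /\
  (* (d) *)
  (forall (s : R) (n : Z),
     fourier (dist_translate s f) n = Cmult (fourier f n) (expi (- (IZR n * s)))) /\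
  (* (e) *)
  (let F := fun x => cp_int f (- PI) x in
   forall n : Z,
     Cmod (fourier f n)
       <= Rabs (F PI) + Rabs (IZR n) * RInt (fun x => Rabs (F x)) (- PI) PI) /\
  (* (f) *)
  (forall n : Z, n <> 0%Z ->
     Cmod (fourier f n) <= 4 * sqrt 2 * Rabs (IZR n) * alexiewicz_norm f) /\
  (* (g) *)
  (little_o_Z (fourier f) IZR /\
   forall psi : nat -> R,
     (forall m : nat, (1 <= m)%nat -> 0 < psi m) ->
     is_domin eventually INR psi ->
     exists h : functional,
       Ac h /\ ~ little_o_Z (fourier h) (fun n => psi (Z.abs_nat n))) /\
  (* (h) *)
  (forall n : Z, n <> 0%Z ->
     Cmod (fourier f n)
       <= 2 * sqrt 2 * Rabs (IZR n)
          * alexiewicz_norm (dist_minus f (dist_translate (PI / IZR n) f))) /\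
  (* (i) *)
  (forall F : R -> R, CkT 0 F ->
     forall n : Z,
       fourier (dist_deriv (dist_of_fun F)) n
       = Cmult (Cmult Ci (RtoC (IZR n))) (fourier (dist_of_fun F) n)) /\
  (* (j) *)
  (forall (k : nat) (F : R -> R), (1 <= k)%nat -> CkT (k - 1) F ->
     (forall n : Z, n <> 0%Z ->
        (forall l : nat, (l <= k)%nat ->
           fourier (dist_of_fun F) n
           = Cmult (Cinv (Cpow (Cmult Ci (RtoC (IZR n))) l))
                   (fourier (dist_deriv_n (dist_of_fun F) l) n)) /\
        Cmod (fourier (dist_of_fun F) n)
        <= 4 * sqrt 2
           * min_upto (fun l => alexiewicz_norm (dist_deriv_n (dist_of_fun F) l)
                                / powerRZ (Rabs (IZR n)) (Z.of_nat l - 1)) k) /\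
     little_o_Z (fourier (dist_of_fun F))
                (fun n => powerRZ (IZR n) (1 - Z.of_nat k))).
Proof.
  destruct hf as [_ [F HF]], hg as [_ [G HG]].
  split; [intro n; exact (fourier_plus f g F G n HF HG)|].
  split; [intros alpha n; exact (Cfourier_Cscal alpha f F n HF)|].
  split; [intro n; exact (fourier_conj f F n HF)|].
  split; [intros s n; exact (fourier_translate s f F n HF)|].
  split.
  { cbv zeta. replace (fun x => cp_int f (- PI) x) with F.
    - intro n. exact (Cmod_fourier_le_integral f F n HF).
    - apply functional_extensionality; intro x. unfold cp_int.
      rewrite (primitive_eq f F HF), (proj1 (proj2 (proj1 HF))). ring. }
  split; [intros n Hn; exact (fourier_le_norm f F n HF Hn)|].
  split; [exact (conj (fourier_little_o f F HF) little_o_sharp)|].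
  split; [intros n Hn; exact (fourier_le_half_period f F n HF Hn)|].
  split; [intros H HH n; exact (fourier_dist_deriv H n HH)|].
  intros [|k] H Hk HH; [lia|]. replace (S k - 1)%nat with k in HH by lia.
  split; [|exact (fourier_smooth_little_o k H HH)].
  intros n Hn. split; [|exact (fourier_le_min_norm k H n HH Hn)].
  intros l Hl. exact (fourier_of_derivative k l H n HH Hl Hn).
Qed.
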